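(* The transformations $\mathbb B_\alpha:\Sigma_{alg}(\mathcal B)\to\Sigma_{alg}(\mathcal B)$, indexed by $\mathbb C$-linear maps $\alpha:\mathcal B\to\mathcal B$, have the following properties. (1) For any two linear maps $\alpha,\beta:\mathcal B\to\mathcal B$ one has $\mathbb B_\alpha\circ\mathbb B_\beta=\mathbb B_{\alpha+\beta}$. (2) If $0:\mathcal B\to\mathcal B$ is the map identically equal to $0$, then $\mathbb B_0$ is the identity map on $\Sigma_{alg}(\mathcal B)$. (3) For every linear map $\alpha:\mathcal B\to\mathcal B$, the map $\mathbb B_\alpha:\Sigma_{alg}(\mathcal B)\to\Sigma_{alg}(\mathcal B)$ is bijective, with inverse $\mathbb B_{-\alpha}$. (4) If $1:\mathcal B\to\mathcal B$ is the identity map, then $\mathbb B_1=\mathbb B$, the Boolean-to-free Bercovici-Pata bijection, i.e. the map $\mathbb B:\Sigma_{alg}(\mathcal B)\to\Sigma_{alg}(\mathcal B)$ determined by $R_{\mathbb B[\mu]}=B_\mu$ for all $\mu\in\Sigma_{alg}(\mathcal B)$.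
   Context: $\mathcal B$ is a fixed unital $C^*$-algebra. Distributions. $\mathcal B\langle \mathcal X\rangle$ is the algebra of polynomials in a formal variable $\mathcal X$ with coefficients in $\mathcal B$, where $\mathcal X$ and $\mathcal B$ are algebraically independent: as a vector space it is $\bigoplus_{n\ge 0}$ of the spans of the monomials $b_0\mathcal X b_1\cdots \mathcal X b_n$, the $n$-th span being isomorphic to $\mathcal B^{\otimes_{\mathbb C}(n+1)}$. $\Sigma_{alg}(\mathcal B)$ is the set of all $\mathbb C$-linear $\mathcal B$-bimodule maps $\mu:\mathcal B\langle\mathcal X\rangle\to\mathcal B$ with $\mu[b]=b$ for $b\in\mathcal B$. Series. $\mathrm{Ser}(\mathcal B)$ is the set of sequences $F=(F^{[n]})_{n\ge1}$ with $F^{[1]}\in\mathcal B$ and $F^{[n]}:\mathcal B^{n-1}\to\mathcal B$ $\mathbb C$-multilinear. For linear $\alpha:\mathcal B\to\mathcal B$, $(\alpha\circ F)^{[n]}:=\alpha\circ F^{[n]}$. The moment series of $\mu\in\Sigma_{alg}(\mathcal B)$ is $M_\mu^{[1]}=\mu[\mathcal X]$, $M_\mu^{[n]}(b_1,\dots,b_{n-1})=\mu[\mathcal Xb_1\mathcal X\cdots b_{n-1}\mathcal X]$; $\mu\mapsto M_\mu$ is a bijection $\Sigma_{alg}(\mathcal B)\to\mathrm{Ser}(\mathcal B)$. Nested functionals. $NC(n)$ is the set of non-crossing partitions of $\{1,\dots,n\}$, and $\mathrm{Int}(n)\subseteq NC(n)$ the set of interval partitions (all blocks are intervals of consecutive integers).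 For $F\in\mathrm{Ser}(\mathcal B)$ and $\pi\in NC(n)$, the multilinear map $F^{[\pi]}:\mathcal B^{n-1}\to\mathcal B$ is obtained by reading the string $W_1b_1W_2b_2\cdots W_{n-1}b_{n-1}W_n$ as a parenthesized expression, where: if $m$ is the minimum of a block $V$ with $|V|=k\ge2$ then $W_m$ is ''$F^{[k]}($''; if $m$ is the maximum of a block with at least 2 elements then $W_m$ is ''$)$''; if $m\in V$ with $\min V<m<\max V$ then $W_m$ is a comma; if $\{m\}$ is a block then $W_m$ is ''$F^{[1]}$''. Example: for $\pi=\{\{1,4,5\},\{2,3\}\}$, $F^{[\pi]}(b_1,\dots,b_4)=F^{[3]}(b_1F^{[2]}(b_2)b_3,b_4)$. If $c:\pi\to\{1,2\}$ is a colouring of the blocks and $F,G\in\mathrm{Ser}(\mathcal B)$, then $(F,G)^{[\pi,c]}$ is defined by the same rule, except that blocks $V$ with $c(V)=1$ use the term $F^{[|V|]}$ and blocks with $c(V)=2$ use the term $G^{[|V|]}$. Transforms. For $\mu\in\Sigma_{alg}(\mathcal B)$, the $R$-transform $R_\mu$ and the $B$-transform $B_\mu$ are the unique series in $\mathrm{Ser}(\mathcal B)$ with $M_\mu^{[n]}=\sum_{\pi\in NC(n)}R_\mu^{[\pi]}$ and $M_\mu^{[n]}=\sum_{\pi\in\mathrm{Int}(n)}B_\mu^{[\pi]}$ for all $n\ge1$. Both $\mu\mapsto R_\mu$ and $\mu\mapsto B_\mu$ are bijections $\Sigma_{alg}(\mathcal B)\to\mathrm{Ser}(\mathcal B)$.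 The maps $\widehat{\mathrm{RB}}_\alpha$ and $\mathbb B_\alpha$. For $\pi\in NC(n)$ write $\pi\ll 1_n$ if $1$ and $n$ lie in the same block of $\pi$; that block is denoted $V_o(\pi)$. Let $\mathrm o_\pi$ be the colouring of $\pi$ with $\mathrm o_\pi(V_o(\pi))=1$ and $\mathrm o_\pi(V)=2$ for all other blocks. For linear $\alpha:\mathcal B\to\mathcal B$, $\widehat{\mathrm{RB}}_\alpha:\mathrm{Ser}(\mathcal B)\to\mathrm{Ser}(\mathcal B)$ is given by $\widehat{\mathrm{RB}}_\alpha(F)^{[n]}=\sum_{\pi\in NC(n),\,\pi\ll1_n}(F,\alpha\circ F)^{[\pi,\mathrm o_\pi]}$, $n\ge1$. For $\mu\in\Sigma_{alg}(\mathcal B)$, $\mathbb B_\alpha(\mu)\in\Sigma_{alg}(\mathcal B)$ is the distribution determined by $R_{\mathbb B_\alpha(\mu)}=\widehat{\mathrm{RB}}_\alpha(R_\mu)$. *)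

(* Defs.v *)
From HB Require Import structures.
From mathcomp Require Import all_boot all_order all_algebra.
From mathcomp Require Import complex.
From mathcomp Require Import all_classical all_reals all_analysis.

Set Implicit Arguments.
Unset Strict Implicit.
Unset Printing Implicit Defensive.

Import Order.TTheory GRing.Theory Num.Theory.

Local Open Scope ring_scope.
Local Open Scope complex_scope.
Local Open Scope quotient_scope.

(** The norm is a field of the mixin and not the norm of [normedModType R[i]]:
    [numDomainType] already joins rings and normed groups, so the hierarchy
    admits no other structure above both [algType] and [normedModType]. *)
HB.mixin Record Algebra_isCstar (R : realType) A of GRing.Algebra R[i] A := {
  star : A -> A ;
  cnorm : A -> R ;
  starK : involutive star ;
  starD : {morph star : x y / x + y} ;
  starZ : forall (c : R[i]) x, star (c *: x) = c^* *: star x ;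
  starM : forall x y, star (x * y) = star y * star x ;
  cnorm_eq0 : forall x, cnorm x = 0 -> x = 0 ;
  cnormD : forall x y, cnorm (x + y) <= cnorm x + cnorm y ;
  cnormZ : forall (c : R[i]) x, (cnorm (c *: x))%:C = `|c| * (cnorm x)%:C ;
  cnormM : forall x y, cnorm (x * y) <= cnorm x * cnorm y ;
  cnorm_star : forall x, cnorm (star x * x) = cnorm x ^+ 2 ;
  cnorm_complete : forall u : nat -> A,
    (forall e : R, 0 < e -> exists N : nat, forall m n : nat,
        (N <= m)%N -> (N <= n)%N -> cnorm (u m - u n) < e) ->
    exists l : A, forall e : R, 0 < e -> exists N : nat, forall n : nat,
        (N <= n)%N -> cnorm (u n - l) < e }.

#[short(type="cstarAlgType")]
HB.structure Definition CstarAlg (R : realType) :=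
  {A of GRing.Algebra R[i] A & Algebra_isCstar R A}.

(** [ncpoly B] is presented by generators (the elements of [B] and one further
    generator) and relations: [ncexpr_eq] is the smallest congruence that makes
    the classes of expressions a unital [K]-algebra in which [B] sits as a unital
    subalgebra.  Scalars act through the elements [c%:A] of [B], which are
    required to be central.  Since no other relation involves the generator
    [NCX], it is algebraically independent of [B]. *)
Section NCPoly.
Variables (K : fieldType) (B : algType K).

Inductive ncexpr : Type :=
| NCX
| NCconst of B
| NCadd of ncexpr & ncexpr
| NCmul of ncexpr & ncexpr.

Inductive ncexpr_eq : ncexpr -> ncexpr -> Prop :=
| nc_refl p : ncexpr_eq p p
| nc_sym p q : ncexpr_eq p q -> ncexpr_eq q p
| nc_trans p q r : ncexpr_eq p q -> ncexpr_eq q r -> ncexpr_eq p r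
| nc_add p p' q q' :
    ncexpr_eq p p' -> ncexpr_eq q q' -> ncexpr_eq (NCadd p q) (NCadd p' q')
| nc_mul p p' q q' :
    ncexpr_eq p p' -> ncexpr_eq q q' -> ncexpr_eq (NCmul p q) (NCmul p' q')
| nc_addA p q r : ncexpr_eq (NCadd p (NCadd q r)) (NCadd (NCadd p q) r)
| nc_addC p q : ncexpr_eq (NCadd p q) (NCadd q p)
| nc_add0 p : ncexpr_eq (NCadd (NCconst 0) p) p
| nc_mulA p q r : ncexpr_eq (NCmul p (NCmul q r)) (NCmul (NCmul p q) r)
| nc_mul1l p : ncexpr_eq (NCmul (NCconst 1) p) p
| nc_mul1r p : ncexpr_eq (NCmul p (NCconst 1)) p
| nc_mul0l p : ncexpr_eq (NCmul (NCconst 0) p) (NCconst 0)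
| nc_mulDl p q r :
    ncexpr_eq (NCmul (NCadd p q) r) (NCadd (NCmul p r) (NCmul q r))
| nc_mulDr p q r :
    ncexpr_eq (NCmul p (NCadd q r)) (NCadd (NCmul p q) (NCmul p r))
| nc_constD a b : ncexpr_eq (NCconst (a + b)) (NCadd (NCconst a) (NCconst b))
| nc_constM a b : ncexpr_eq (NCconst (a * b)) (NCmul (NCconst a) (NCconst b))
| nc_scalC (c : K) p :
    ncexpr_eq (NCmul (NCconst c%:A) p) (NCmul p (NCconst c%:A)).

HB.instance Definition _ := gen_eqMixin ncexpr.
HB.instance Definition _ := gen_choiceMixin ncexpr.

Definition ncexpr_eqb (p q : ncexpr) : bool := `[< ncexpr_eq p q >].

Lemma ncexpr_eqb_refl : reflexive ncexpr_eqb.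
Proof. by move=> p; apply/asboolP; exact: nc_refl. Qed.

Lemma ncexpr_eqb_sym : symmetric ncexpr_eqb.
Proof.
by move=> p q; apply/idP/idP => /asboolP h; apply/asboolP; exact: nc_sym.
Qed.

Lemma ncexpr_eqb_trans : transitive ncexpr_eqb.
Proof.
by move=> q p r /asboolP h /asboolP h'; apply/asboolP; exact: nc_trans h h'.
Qed.

Canonical ncexpr_equiv :=
  EquivRel ncexpr_eqb ncexpr_eqb_refl ncexpr_eqb_sym ncexpr_eqb_trans.

Definition ncpoly : Type := {eq_quot ncexpr_equiv}.
HB.instance Definition _ := Choice.on ncpoly.
HB.instance Definition _ := EqQuotient.on ncpoly.

Lemma ncpoly_eqP (p q : ncexpr) :
  \pi_ncpoly p = \pi_ncpoly q <-> ncexpr_eq p q.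
Proof.
split=> [/eqmodP/asboolP//|h]; apply/eqmodP; exact/asboolP.
Qed.

Definition ncX : ncpoly := \pi_ncpoly NCX.
Definition ncC (b : B) : ncpoly := \pi_ncpoly (NCconst b).
Definition ncpoly_add (x y : ncpoly) : ncpoly :=
  \pi_ncpoly (NCadd (repr x) (repr y)).
Definition ncpoly_mul (x y : ncpoly) : ncpoly :=
  \pi_ncpoly (NCmul (repr x) (repr y)).
Definition ncpoly_opp (x : ncpoly) : ncpoly := ncpoly_mul (ncC (- 1)) x.
Definition ncpoly_scale (c : K) (x : ncpoly) : ncpoly := ncpoly_mul (ncC c%:A) x.

Lemma nc_repr_pi (p : ncexpr) : ncexpr_eq (repr (\pi_ncpoly p)) p.
Proof. by apply/ncpoly_eqP; rewrite reprK. Qed.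

Lemma pi_ncadd (p q : ncexpr) :
  \pi_ncpoly (NCadd p q) = ncpoly_add (\pi_ncpoly p) (\pi_ncpoly q).
Proof.
by apply/ncpoly_eqP; apply: nc_add; apply: nc_sym; exact: nc_repr_pi.
Qed.

Lemma pi_ncmul (p q : ncexpr) :
  \pi_ncpoly (NCmul p q) = ncpoly_mul (\pi_ncpoly p) (\pi_ncpoly q).
Proof.
by apply/ncpoly_eqP; apply: nc_mul; apply: nc_sym; exact: nc_repr_pi.
Qed.

Lemma ncpoly_ind (P : ncpoly -> Prop) :
  (forall p, P (\pi_ncpoly p)) -> forall x, P x.
Proof. by move=> h x; rewrite -[x]reprK. Qed.

Let ncp_addA : associative ncpoly_add.
Proof.
elim/ncpoly_ind => p; elim/ncpoly_ind => q; elim/ncpoly_ind => r.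
by rewrite -!pi_ncadd; apply/ncpoly_eqP; constructor.
Qed.

Let ncp_addC : commutative ncpoly_add.
Proof.
elim/ncpoly_ind => p; elim/ncpoly_ind => q.
by rewrite -!pi_ncadd; apply/ncpoly_eqP; constructor.
Qed.

Let ncp_add0 : left_id (ncC 0) ncpoly_add.
Proof.
by elim/ncpoly_ind => p; rewrite -!pi_ncadd; apply/ncpoly_eqP; constructor.
Qed.

Let ncp_mulA : associative ncpoly_mul.
Proof.
elim/ncpoly_ind => p; elim/ncpoly_ind => q; elim/ncpoly_ind => r.
by rewrite -!pi_ncmul; apply/ncpoly_eqP; constructor.
Qed.

Let ncp_mul1l : left_id (ncC 1) ncpoly_mul.
Proof.
by elim/ncpoly_ind => p; rewrite -!pi_ncmul; apply/ncpoly_eqP; constructor.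
Qed.

Let ncp_mul1r : right_id (ncC 1) ncpoly_mul.
Proof.
by elim/ncpoly_ind => p; rewrite -!pi_ncmul; apply/ncpoly_eqP; constructor.
Qed.

Let ncp_mul0l : left_zero (ncC 0) ncpoly_mul.
Proof.
by elim/ncpoly_ind => p; rewrite -!pi_ncmul; apply/ncpoly_eqP; constructor.
Qed.

Let ncp_mulDl : left_distributive ncpoly_mul ncpoly_add.
Proof.
elim/ncpoly_ind => p; elim/ncpoly_ind => q; elim/ncpoly_ind => r.
by rewrite -!(pi_ncadd, pi_ncmul); apply/ncpoly_eqP; constructor.
Qed.

Let ncp_mulDr : right_distributive ncpoly_mul ncpoly_add.
Proof.
elim/ncpoly_ind => p; elim/ncpoly_ind => q; elim/ncpoly_ind => r.
by rewrite -!(pi_ncadd, pi_ncmul); apply/ncpoly_eqP; constructor.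
Qed.

Let ncp_constD a b : ncC (a + b) = ncpoly_add (ncC a) (ncC b).
Proof. by rewrite -!pi_ncadd; apply/ncpoly_eqP; constructor. Qed.

Let ncp_constM a b : ncC (a * b) = ncpoly_mul (ncC a) (ncC b).
Proof. by rewrite -!pi_ncmul; apply/ncpoly_eqP; constructor. Qed.

Let ncp_scalC (c : K) x : ncpoly_mul (ncC c%:A) x = ncpoly_mul x (ncC c%:A).
Proof.
by elim/ncpoly_ind: x => p; rewrite -!pi_ncmul; apply/ncpoly_eqP; constructor.
Qed.

Let ncp_addN : left_inverse (ncC 0) ncpoly_opp ncpoly_add.
Proof.
by move=> x; rewrite -{2}[x]ncp_mul1l -ncp_mulDl -ncp_constD addNr ncp_mul0l.
Qed.

Fixpoint ncexpr_at0 (p : ncexpr) : B :=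
  match p with
  | NCX => 0
  | NCconst b => b
  | NCadd p q => ncexpr_at0 p + ncexpr_at0 q
  | NCmul p q => ncexpr_at0 p * ncexpr_at0 q
  end.

Lemma ncexpr_at0_eq p q : ncexpr_eq p q -> ncexpr_at0 p = ncexpr_at0 q.
Proof.
elim=> {p q} /= [//|//|p q r _ -> _ -> //|p p' q q' _ -> _ -> //
  |p p' q q' _ -> _ -> //|p q r|p q|p|p q r|p|p|p|p q r|p q r|//|//|c p].
- exact: addrA.
- exact: addrC.
- exact: add0r.
- exact: mulrA.
- exact: mul1r.
- exact: mulr1.
- exact: mul0r.
- exact: mulrDl.
- exact: mulrDr.
- by rewrite mulr_algl mulr_algr.
Qed.

Let ncp_one_neq0 : ncC 1 != ncC 0.
Proof.
by apply/eqP => /ncpoly_eqP /ncexpr_at0_eq /= /eqP; rewrite oner_eq0.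
Qed.

HB.instance Definition _ := GRing.isZmodule.Build ncpoly ncp_addA ncp_addC ncp_add0 ncp_addN.
HB.instance Definition _ := GRing.Zmodule_isNzRing.Build ncpoly
  ncp_mulA ncp_mul1l ncp_mul1r ncp_mulDl ncp_mulDr ncp_one_neq0.

Let ncp_scaleA a b x : ncpoly_scale a (ncpoly_scale b x) = ncpoly_scale (a * b) x.
Proof.
by rewrite /ncpoly_scale ncp_mulA -ncp_constM -scalerAl mul1r scalerA.
Qed.

Let ncp_scale1 : left_id 1 ncpoly_scale.
Proof. by move=> x; rewrite /ncpoly_scale scale1r ncp_mul1l. Qed.

Let ncp_scaleDr : right_distributive ncpoly_scale +%R.
Proof. by move=> c x y; exact: ncp_mulDr. Qed.

Let ncp_scaleDl x : {morph ncpoly_scale^~ x : a b / a + b}.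
Proof. by move=> a b; rewrite /ncpoly_scale scalerDl ncp_constD; exact: ncp_mulDl. Qed.

HB.instance Definition _ := GRing.Zmodule_isLmodule.Build K ncpoly
  ncp_scaleA ncp_scale1 ncp_scaleDr ncp_scaleDl.

Let ncp_scaleAl (c : K) (x y : ncpoly) : c *: (x * y) = (c *: x) * y.
Proof. exact: ncp_mulA. Qed.

HB.instance Definition _ := GRing.Lmodule_isLalgebra.Build K ncpoly ncp_scaleAl.

Let ncp_scaleAr (c : K) (x y : ncpoly) : c *: (x * y) = x * (c *: y).
Proof.
rewrite /GRing.scale/= /ncpoly_scale.
by rewrite [LHS]ncp_mulA [in LHS]ncp_scalC -[LHS]ncp_mulA.
Qed.

HB.instance Definition _ := GRing.Lalgebra_isAlgebra.Build K ncpoly ncp_scaleAr.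

Let ncC_zmod : zmod_morphism ncC.
Proof.
move=> a b; rewrite ncp_constD; congr (ncpoly_add _ _).
by rewrite -[LHS]/(ncC (- b)) -mulN1r ncp_constM.
Qed.

Let ncC_monoid : monoid_morphism ncC.
Proof. by split=> // a b; rewrite ncp_constM. Qed.

Let ncC_scalable : scalable ncC.
Proof. by move=> c b; rewrite -[in LHS](mul1r b) scalerAl ncp_constM. Qed.

HB.instance Definition _ := GRing.isZmodMorphism.Build B ncpoly ncC ncC_zmod.
HB.instance Definition _ := GRing.isMonoidMorphism.Build B ncpoly ncC ncC_monoid.
HB.instance Definition _ := GRing.isScalable.Build K B ncpoly *:%R ncC ncC_scalable.

End NCPoly.

Section Transforms.
Variables (K : fieldType) (B : algType K).

Definition tupd (T : Type) n (b : n.-tuple T) (i : 'I_n) (x : T) : n.-tuple T :=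
  [tuple if j == i then x else tnth b j | j < n].

Definition multilinear n (f : n.-tuple B -> B) : Prop :=
  forall (b : n.-tuple B) (i : 'I_n), linear (fun x => f (tupd b i x)).

(** For [b : n.-tuple B], [F n b] is the value at [b] of the term of index [n.+1]
    of the series, i.e. F^[n+1](b_1, ..., b_n). *)
Record ser := Ser {
  ser_fun :> forall n, n.-tuple B -> B ;
  ser_multilinear : forall n, multilinear (@ser_fun n) }.

HB.instance Definition _ := gen_eqMixin ser.
HB.instance Definition _ := gen_choiceMixin ser.

Lemma val_tupd n (b : n.-tuple B) (i : 'I_n) x :
  tval (tupd b i x) = take i b ++ x :: drop i.+1 b.
Proof.
have lt_in : (i < size b)%N by rewrite size_tuple.
have sz : size (tval (tupd b i x)) = n by rewrite size_tuple.
apply: (@eq_from_nth _ 0); rewrite sz.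
  by rewrite size_cat /= size_takel ?(ltnW lt_in)// size_drop addnS -addSn
    subnKC ?size_tuple.
move=> j ltj.
rewrite -[j]/(val (Ordinal ltj)) -tnth_nth tnth_mktuple nth_cat.
rewrite size_takel ?(ltnW lt_in)// (tnth_nth 0) -val_eqE /=.
case: (ltngtP j i) => [lt_ji|lt_ij|->].
- by rewrite nth_take.
- have [k ->] : exists k, j = (i + k.+1)%N.
    by exists (j - i.+1)%N; rewrite addnS -addSn subnKC.
  by rewrite addKn /= nth_drop addSnnS.
- by rewrite subnn.
Qed.

Lemma ser_in_tuple (F : ser) n (b : n.-tuple B) : F _ (in_tuple b) = F _ b.
Proof.
case: b => s /= sz; have /eqP E := sz; case: n / E sz => sz.
by congr (F _ _); exact: val_inj.
Qed.

Lemma ser_linear (F : ser) s1 s2 (g : B -> B) : linear g ->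
  linear (fun x => F _ (in_tuple (s1 ++ g x :: s2))).
Proof.
move=> ling; pose b0 := in_tuple (s1 ++ 0 :: s2).
have lti : (size s1 < size (s1 ++ 0%R :: s2))%N.
  by rewrite size_cat /= addnS ltnS leq_addr.
have E y : F _ (in_tuple (s1 ++ y :: s2)) = F _ (tupd b0 (Ordinal lti) y).
  rewrite -(ser_in_tuple F (tupd _ _ _)) val_tupd /=.
  by rewrite take_size_cat // drop_cat ltnNge leqnSn /= subSnn /= drop0.
move=> k x y; rewrite !E ling; exact: ser_multilinear.
Qed.

Lemma zero_ser_multilinear n : multilinear (fun _ : n.-tuple B => 0).
Proof. by move=> b i k x y; rewrite scaler0 addr0. Qed.

Definition zero_ser : ser := Ser zero_ser_multilinear.

Lemma comp_ser_multilinear (alpha : {linear B -> B}) (F : ser) n :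
  multilinear (fun b : n.-tuple B => alpha (F _ b)).
Proof. by move=> b i k x y /=; rewrite ser_multilinear linearP. Qed.

Definition comp_ser (alpha : {linear B -> B}) (F : ser) : ser :=
  Ser (comp_ser_multilinear alpha F).

Lemma multilinear_sum (I : finType) (P : pred I) n
    (f : I -> n.-tuple B -> B) :
  (forall i, multilinear (f i)) ->
  multilinear (fun b => \sum_(i | P i) f i b).
Proof.
move=> linf b i k x y; rewrite scaler_sumr -big_split /=.
by apply: eq_bigr => j _; exact: linf.
Qed.

Definition noncrossing n (P : {set {set 'I_n}}) : bool :=
  [forall V in P, forall W in P,
   forall i in V, forall j in W, forall k in V, forall l in W,
     [&& i < j, j < k & k < l]%N ==> (V == W)].

Definition NC n : {set {set {set 'I_n}}} :=
  [set P | finset.partition P [set: 'I_n] && noncrossing P].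

Definition Intp n : {set {set {set 'I_n}}} :=
  [set P | finset.partition P [set: 'I_n] &&
    [forall V in P, forall i in V, forall j in V, forall k : 'I_n,
       (i <= k <= j)%N ==> (k \in V)]].

(** The symbols occurring in the string W_1 b_1 W_2 ... b_{n-1} W_n;
    [SOpen F] stands for "F^[k](", where [k] is the number of arguments found
    before the matching closing parenthesis. *)
Inductive symbol : Type :=
| SOpen of ser
| SComma
| SClose
| SSingle of ser
| SArg of B.

(** The string is read from left to right.  A state [(x, st)] consists of the
    product [x] of the factors read since the last opening parenthesis or comma
    (or since the beginning), and of the list [st] of the currently open
    parentheses, innermost first; an entry [(y, F, s)] records the product [y]
    of the factors preceding "F^[k](" and the list [s] of the arguments of [F]
    already completed. *)
Definition frame : Type := (B * ser * seq B)%type.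

Definition read_symbol (s : B * seq frame) (w : symbol) : B * seq frame :=
  match w, s with
  | SOpen F, (x, st) => (1, (x, F, [::]) :: st)
  | SComma, (x, (y, F, s) :: st) => (1, (y, F, rcons s x) :: st)
  | SClose, (x, (y, F, s) :: st) => (y * F _ (in_tuple (rcons s x)), st)
  | SSingle F, (x, st) => (x * F _ [tuple], st)
  | SArg b, (x, st) => (x * b, st)
  | _, (_, [::]) => s
  end.

(** The value is [0] if the parentheses are not balanced, which does not happen
    for the strings of non-crossing partitions. *)
Definition eval_string (w : seq symbol) : B :=
  if foldl read_symbol (1, [::]) w is (x, [::]) then x else 0.

Section Nested.
Variables (n : nat) (S : {set 'I_n.+1} -> ser) (P : {set {set 'I_n.+1}}).

Definition nested_symbol (m : 'I_n.+1) : symbol :=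
  let V := finset.pblock P m in
  if #|V| == 1%N then SSingle (S V)
  else if [forall j in V, m <= j]%N then SOpen (S V)
  else if [forall j in V, j <= m]%N then SClose
  else SComma.

Definition nested_string (b : n.-tuple B) : seq symbol :=
  nested_symbol ord0 ::
  flatten [seq [:: SArg (tnth b i); nested_symbol (lift ord0 i)] | i <- enum 'I_n].

(** Each block [V] of [P] uses the term of index #|V| of the series [S V]. *)
Definition nested (b : n.-tuple B) : B := eval_string (nested_string b).

End Nested.

Inductive hot_state : (B -> B * seq frame) -> Prop :=
| hot_cur (g : B -> B) st : linear g -> hot_state (fun x => (g x, st))
| hot_fst a (g : B -> B) F s st1 st2 : linear g ->
    hot_state (fun x => (a, st1 ++ (g x, F, s) :: st2))
| hot_arg a y F (g : B -> B) s1 s2 st1 st2 : linear g ->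
    hot_state (fun x => (a, st1 ++ (y, F, s1 ++ g x :: s2) :: st2)).

Lemma linear_mulr (g : B -> B) y : linear g -> linear (fun x => g x * y).
Proof. by move=> ling k u v; rewrite ling mulrDl scalerAl. Qed.

Lemma linear_mull (g : B -> B) y : linear g -> linear (fun x => y * g x).
Proof. by move=> ling k u v; rewrite ling mulrDr scalerAr. Qed.

Lemma hot_read_symbol f w :
  hot_state f -> hot_state (fun x => read_symbol (f x) w).
Proof.
case=> [g st ling|a g F s st1 st2 ling|a y F g s1 s2 st1 st2 ling].
- case: w => [G|||G|b] /=.
  + exact: (@hot_fst 1 g G [::] [::] st).
  + case: st => [|[[y F] s] st]; first exact: hot_cur.
    rewrite (_ : (fun x : B => _) = (fun x =>
      (1, [::] ++ (y, F, s ++ g x :: [::]) :: st))).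
      exact: hot_arg.
    by apply/funext => x; rewrite cats1.
  + case: st => [|[[y F] s] st]; first exact: hot_cur.
    apply: hot_cur; apply: linear_mull.
    by under eq_fun do rewrite -cats1; exact: ser_linear.
  + exact: hot_cur (linear_mulr _ ling).
  + exact: hot_cur (linear_mulr _ ling).
- case: w => [G|||G|b] /=.
  + exact: (@hot_fst 1 g F s ((a, G, [::]) :: st1) st2).
  + case: st1 => [|[[y G] s'] st1] /=.
      exact: (@hot_fst 1 g F (rcons s a) [::] st2).
    exact: (@hot_fst 1 g F s ((y, G, rcons s' a) :: st1) st2).
  + case: st1 => [|[[y G] s'] st1] /=.
      exact: hot_cur (linear_mulr _ ling).
    exact: hot_fst.
  + exact: hot_fst.
  + exact: hot_fst.
- case: w => [G|||G|b] /=.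
  + exact: (@hot_arg 1 y F g s1 s2 ((a, G, [::]) :: st1) st2).
  + case: st1 => [|[[z G] s'] st1] /=.
      under eq_fun do rewrite rcons_cat rcons_cons.
      exact: (@hot_arg 1 y F g s1 (rcons s2 a) [::] st2).
    exact: (@hot_arg 1 y F g s1 s2 ((z, G, rcons s' a) :: st1) st2).
  + case: st1 => [|[[z G] s'] st1] /=.
      apply: hot_cur; apply: linear_mull.
      by under eq_fun do rewrite rcons_cat rcons_cons; exact: ser_linear.
    exact: hot_arg.
  + exact: hot_arg.
  + exact: hot_arg.
Qed.

Lemma hot_foldl w f : hot_state f ->
  linear (fun x => if foldl read_symbol (f x) w is (y, [::]) then y else 0).
Proof.
elim: w f => [|w ws IHw] f hotf /=; last exact: IHw (hot_read_symbol w hotf).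
have lin0 : linear (fun _ : B => 0 : B) by move=> k x y; rewrite scaler0 addr0.
by case: hotf => [g [|//] //|a g F s [|//] //|a y F g s1 s2 [|//] //].
Qed.

Lemma eval_string_linear w1 w2 :
  linear (fun x => eval_string (w1 ++ SArg x :: w2)).
Proof.
rewrite /eval_string; under eq_fun do rewrite foldl_cat /=.
case: (foldl _ _ w1) => [a st] /=.
apply: (@hot_foldl w2 (fun x => (a * x, st))).
by apply: hot_cur; apply: (@linear_mull id).
Qed.

Lemma nested_multilinear n (S : {set 'I_n.+1} -> ser) (P : {set {set 'I_n.+1}}) :
  multilinear (nested S P).
Proof.
move=> b i; rewrite /nested /nested_string.
have /splitPr e : i \in enum 'I_n by rewrite mem_enum.
have := enum_uniq 'I_n; case: e => s1 s2.
rewrite cat_uniq /= negb_or => /and3P[_ /andP[is1 _] /andP[is2 _]].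
pose W (b : n.-tuple B) (j : 'I_n) :=
  [:: SArg (tnth b j); nested_symbol S P (lift ord0 j)].
have E s x : i \notin s -> [seq W (tupd b i x) j | j <- s] = [seq W b j | j <- s].
  move=> nis; apply/eq_in_map => j js; rewrite /W tnth_mktuple ifN //.
  by apply: contraNneq nis => <-.
under eq_fun => x.
  rewrite map_cat /= -/(W _) (E _ x is1) (E _ x is2) tnth_mktuple eqxx.
  rewrite flatten_cat /= -cat_cons.
  over.
exact: eval_string_linear.
Qed.

Record distr := Distr {
  distr_fun :> {linear ncpoly B -> B} ;
  distr_bimod : forall (b b' : B) (p : ncpoly B),
    distr_fun (ncC b * p * ncC b') = b * distr_fun p * b' ;
  distr_ncC : forall b : B, distr_fun (ncC b) = b }.

HB.instance Definition _ := gen_eqMixin distr.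
HB.instance Definition _ := gen_choiceMixin distr.

Definition moment (mu : distr) n (b : n.-tuple B) : B :=
  mu (ncX B * \prod_(x <- b) (ncC x * ncX B)).

Lemma moment_multilinear (mu : distr) n : multilinear (@moment mu n).
Proof.
move=> b i k x y; rewrite /moment !val_tupd !big_cat /= !big_cons.
by rewrite linearP /= !(mulrDl, mulrDr) -!(scalerAl, scalerAr) linearP.
Qed.

Definition moment_series (mu : distr) : ser := Ser (moment_multilinear mu).

Definition is_Rtransform (mu : distr) (F : ser) : Prop :=
  forall n (b : n.-tuple B),
    moment_series mu n b = \sum_(P in NC n.+1) nested (fun=> F) P b.

Definition is_Btransform (mu : distr) (F : ser) : Prop :=
  forall n (b : n.-tuple B),
    moment_series mu n b = \sum_(P in Intp n.+1) nested (fun=> F) P b.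

(** The unique series with the given property; [zero_ser] is only the default
    value required by [xget]. *)
Definition Rtransform (mu : distr) : ser :=
  xget zero_ser [set F | is_Rtransform mu F]%classic.

Definition Btransform (mu : distr) : ser :=
  xget zero_ser [set F | is_Btransform mu F]%classic.

Definition coloured (F G : ser) n (c : {set 'I_n} -> bool) (V : {set 'I_n}) : ser :=
  if c V then F else G.

(** The sum runs over P << 1_n, and the outer block [pblock P ord0], which
    contains both 1 and n, is the only one to receive the first colour. *)
Definition RBhat_fun (alpha : {linear B -> B}) (F : ser) n (b : n.-tuple B) : B :=
  \sum_(P in NC n.+1 | finset.pblock P ord0 == finset.pblock P ord_max)
    nested (coloured F (comp_ser alpha F) (pred1 (finset.pblock P ord0))) P b.

Lemma RBhat_multilinear alpha F n : multilinear (@RBhat_fun alpha F n).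
Proof. by apply: multilinear_sum => P; exact: nested_multilinear. Qed.

Definition RBhat (alpha : {linear B -> B}) (F : ser) : ser :=
  Ser (RBhat_multilinear alpha F).

Definition ncpoly_at0 (p : ncpoly B) : B := ncexpr_at0 (repr p).

Lemma ncpoly_at0_pi (p : ncexpr B) : ncpoly_at0 (\pi_(ncpoly B) p) = ncexpr_at0 p.
Proof. exact: ncexpr_at0_eq (nc_repr_pi p). Qed.

Lemma ncpoly_at0D p q : ncpoly_at0 (p + q) = ncpoly_at0 p + ncpoly_at0 q.
Proof. exact: ncpoly_at0_pi. Qed.

Lemma ncpoly_at0M p q : ncpoly_at0 (p * q) = ncpoly_at0 p * ncpoly_at0 q.
Proof. exact: ncpoly_at0_pi. Qed.

Lemma ncpoly_at0_ncC b : ncpoly_at0 (ncC b) = b.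
Proof. exact: ncpoly_at0_pi. Qed.

Lemma ncpoly_at0_linear : linear ncpoly_at0.
Proof.
move=> k p q; rewrite ncpoly_at0D; congr (_ + _).
by rewrite -[k *: p]/(ncC k%:A * p) ncpoly_at0M ncpoly_at0_ncC mulr_algl.
Qed.

HB.instance Definition _ :=
  GRing.isLinear.Build K (ncpoly B) B *:%R ncpoly_at0 ncpoly_at0_linear.

Lemma ncpoly_at0_bimod b b' p :
  ncpoly_at0 (ncC b * p * ncC b') = b * ncpoly_at0 p * b'.
Proof. by rewrite !ncpoly_at0M !ncpoly_at0_ncC. Qed.

Definition distr0 : distr := Distr ncpoly_at0_bimod ncpoly_at0_ncC.

(** The unique distribution with the given R-transform; [distr0] is only the
    default value required by [xget]. *)
Definition distr_of_Rtransform (F : ser) : distr :=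
  xget distr0 [set mu | Rtransform mu = F]%classic.

Definition BB (alpha : {linear B -> B}) (mu : distr) : distr :=
  distr_of_Rtransform (RBhat alpha (Rtransform mu)).

Definition bercovici_pata (mu : distr) : distr :=
  distr_of_Rtransform (Btransform mu).

End Transforms.

(* Main.v *)
Require Import Defs.
From HB Require Import structures.
From mathcomp Require Import all_boot all_order all_algebra.
From mathcomp Require Import complex.
From mathcomp Require Import all_classical all_reals all_analysis.

Set Implicit Arguments.
Unset Strict Implicit.
Unset Printing Implicit Defensive.

Import Order.TTheory GRing.Theory Num.Theory.

Local Open Scope ring_scope.

(** A series in Ser(B) is read as a formal noncommutative power series in one
    variable X, that is, as a function on words over B; the coefficient F^[n+1]
    sits in degree n.  Concatenation of words gives a product, and substituting
    a series with zero constant term for X gives a composition, which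
    distributes over products and is associative when the outer series is
    multilinear ([ws_compMl], [ws_compA]).

    For a series g let Phi_g ([ws_arg g]) be the unique solution of
      Phi = X + X (g o Phi) Phi.
    It is what one argument of an outer block can contain when all the blocks
    nested inside use g: either a single letter, or a letter b followed by one
    further block, with its own arguments filled in the same way, followed by
    another such content.  Decomposing a non-crossing partition along the block
    of its first point gives ([sum_nested])
      sum over NC = (F o Phi_G) Y,   Y = 1 + X (G0 o Phi_G) Y,
    where the block of the first point uses F, the other outer blocks use G0
    and the nested blocks use G.  Three specializations are needed:
    - F = G0 = G gives the free moment-cumulant formula;
    - G = 0, F = G0 kills every partition with a nested block and leaves the
      interval partitions, hence the boolean moment-cumulant formula;
    - G0 = 0, G = alpha o F kills every partition whose first and last points
      lie in different blocks, hence RBhat_alpha(F) = F o Phi_{alpha o F}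
      ([RBhatE]).

    The theorem follows by algebra.  Comparing the first two formulas, the free
    moments of F are the boolean moments of RBhat_1(F) ([free_series_boolean]),
    which gives the statement on the Boolean-to-free
    bijection.  The functional equation implies
      Phi_f o Phi_{g o Phi_f} = Phi_{g + f}      ([ws_arg_comp]),
    and taking f = beta o F, g = alpha o F this says that
    RBhat_alpha RBhat_beta = RBhat_{alpha+beta} ([RBhat_comp]); also Phi_0 = X, so
    RBhat_0 is the identity.  Finally these identities are transported to
    distributions: the boolean formula M = F (1 + X M) can be inverted
    explicitly, therefore so can the free one, and a distribution is the same
    thing as its moment series ([moment_series_distr], [moment_series_inj]).

    The decomposition of NC is carried out on strings.  A non-crossing
    partition is determined by the sets of minima and maxima of its blocks, and
    the words of such marks that occur are exactly those along which the stack
    of open blocks never underflows and ends empty ([big_NC_word]); the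
    evaluation of a nested functional reads that word from left to right. *)

(** * Splittings and segmentations of words *)

Fixpoint splits (T : Type) (s : seq T) : seq (seq T * seq T) :=
  ([::], s) ::
    (if s is x :: s' then [seq (x :: p.1, p.2) | p <- splits s'] else [::]).
Arguments splits : simpl never.

Definition prepend (T : Type) (x : T) (p : seq (seq T)) : seq (seq (seq T)) :=
  ([:: x] :: p) :: (if p is u :: p' then [:: (x :: u) :: p'] else [::]).

(** All ways to cut a word into consecutive nonempty segments: the first letter
    either is a segment or is prepended to the first segment of the rest. *)
Fixpoint segmentations (T : Type) (s : seq T) : seq (seq (seq T)) :=
  if s is x :: s' then flatten [seq prepend x p | p <- segmentations s']
  else [:: [::]].
Arguments segmentations : simpl never.

Section Splittings.
Variables (T : Type) (V : nmodType).

Lemma splits_nil : splits [::] = [:: ([::], [::])] :> seq (seq T * seq T).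
Proof. by []. Qed.

Lemma segmentations_nil : segmentations [::] = [:: [::]] :> seq (seq (seq T)).
Proof. by []. Qed.

Lemma splits_cons (h : seq T -> seq T -> V) x s :
  \sum_(p <- splits (x :: s)) h p.1 p.2 =
    h [::] (x :: s) + \sum_(p <- splits s) h (x :: p.1) p.2.
Proof. by rewrite big_cons big_map. Qed.

(** Both sides sum over the ways to cut a word into three parts. *)
Lemma splits_assoc (h : seq T -> seq T -> seq T -> V) s :
  \sum_(p <- splits s) \sum_(q <- splits p.1) h q.1 q.2 p.2 =
  \sum_(p <- splits s) \sum_(q <- splits p.2) h p.1 q.1 q.2.
Proof.
elim: s h => [|x s IHs] h; first by rewrite splits_nil !big_seq1 /=.
rewrite (splits_cons (fun u v => \sum_(q <- splits u) h q.1 q.2 v)).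
rewrite (splits_cons (fun u v => \sum_(q <- splits v) h u q.1 q.2)) /= splits_nil big_seq1.
under eq_bigr => p _ do rewrite (splits_cons (fun u v => h u v p.2)).
rewrite big_split /= addrA (IHs (fun u => h (x :: u))); congr (_ + _).
by rewrite (splits_cons (h [::])).
Qed.

Lemma eq_splits (h h' : seq T -> seq T -> V) s :
  (forall u v, (size u + size v = size s)%N -> h u v = h' u v) ->
  \sum_(p <- splits s) h p.1 p.2 = \sum_(p <- splits s) h' p.1 p.2.
Proof.
elim: s h h' => [|x s IHs] h h' E; first by rewrite splits_nil !big_seq1 /= E.
by rewrite !splits_cons E //; congr (_ + _); apply: (IHs (fun u => h (x :: u)) (fun u => h' (x :: u))) => u v uv; apply: E; rewrite /= -uv.
Qed.

(** Isolating the first segment, which turns inductions on a segmentation into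
    inductions on the length of the word. *)
Lemma segmentations_cons (h : seq (seq T) -> V) x s :
  \sum_(p <- segmentations (x :: s)) h p =
  \sum_(q <- splits s) \sum_(p <- segmentations q.2) h ((x :: q.1) :: p).
Proof.
elim: s x h => [|y s IHs] x h.
  by rewrite splits_nil !big_seq1.
rewrite (splits_cons (fun u v => \sum_(p <- segmentations v) h ((x :: u) :: p))).
rewrite [segmentations (x :: _)]/segmentations -/segmentations.
rewrite -/(segmentations (y :: s)).
rewrite big_flatten big_map.
(* The contribution of the segmentations in which x is glued to the first
   segment; there is none when the rest is empty. *)
pose h' p := if p is u :: p' then h ((x :: u) :: p') else 0.
rewrite (eq_bigr (fun p => h ([:: x] :: p) + h' p)); last first.
  by move=> [|u p] _ /=; rewrite !big_cons big_nil ?addr0.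
by rewrite big_split /= (IHs y h').
Qed.

End Splittings.

(** Cutting a segmentation in two is cutting the word in two and then segmenting
    each part.  This is the multiplicativity of composition in combinatorial
    form. *)
Lemma segmentations_splits (T : Type) (V : nmodType)
    (h : seq (seq T) -> seq (seq T) -> V) s :
  \sum_(p <- segmentations s) \sum_(q <- splits p) h q.1 q.2 =
  \sum_(q <- splits s) \sum_(p1 <- segmentations q.1)
    \sum_(p2 <- segmentations q.2) h p1 p2.
Proof.
have [n] := ubnP (size s); elim: n => // n IHn in s h *.
case: s => [|x s]; first by rewrite !(splits_nil, segmentations_nil, big_seq1).
rewrite ltnS => les.
rewrite segmentations_cons.
rewrite (splits_cons (fun u v => \sum_(p1 <- segmentations u)
  \sum_(p2 <- segmentations v) h p1 p2)) segmentations_nil big_seq1.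
under eq_bigr do under eq_bigr do rewrite splits_cons.
under eq_bigr do rewrite big_split /=.
rewrite big_split -(segmentations_cons (h [::])); congr (_ + _).
under [RHS]eq_bigr => q _ do rewrite (segmentations_cons (fun p =>
   \sum_(p2 <- segmentations q.2) h p p2)).
rewrite (splits_assoc (fun u v w => \sum_(p1 <- segmentations v)
  \sum_(p2 <- segmentations w) h ((x :: u) :: p1) p2)).
apply: (eq_splits (h := fun u v => \sum_(p <- segmentations v)
  \sum_(q <- splits p) h ((x :: u) :: q.1) q.2)
  (h' := fun u v => \sum_(q <- splits v)
     \sum_(p1 <- segmentations q.1)
        \sum_(p2 <- segmentations q.2) h ((x :: u) :: p1) p2)).
move=> u v uv; apply: (IHn _ (fun p1 p2 => h ((x :: u) :: p1) p2)).
by move: les; rewrite /= -uv; apply: leq_ltn_trans; exact: leq_addl.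
Qed.

Lemma splits_map (T T' : Type) (f : T -> T') s :
  splits (map f s) = [seq (map f p.1, map f p.2) | p <- splits s].
Proof.
elim: s => //= x s IHs.
by rewrite /splits /= -!/(splits _) IHs -!map_comp.
Qed.

(** * The ring of formal series and their composition *)

Section Series.
Variables (K : fieldType) (B : algType K).

(** A named copy of [seq B -> B], so that its product is the Cauchy product for
    concatenation and not the pointwise one. *)
Definition wordseries : Type := seq B -> B.
HB.instance Definition _ := GRing.Zmodule.copy wordseries (seq B -> B).
Implicit Types f g h : wordseries.

Definition ws_one : wordseries := fun s => if s is [::] then 1 else 0.
Definition ws_mul f g : wordseries :=
  fun s => \sum_(p <- splits s) f p.1 * g p.2.

Lemma ws_addE f g s : (f + g) s = f s + g s. Proof. by []. Qed.

Let ws_mulA : associative ws_mul.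
Proof.
move=> f g h; apply/funext => s; rewrite /ws_mul.
under eq_bigr do rewrite mulr_sumr.
under [RHS]eq_bigr do rewrite mulr_suml.
rewrite (splits_assoc (fun u v w => f u * g v * h w)).
by under eq_bigr do under eq_bigr do rewrite mulrA.
Qed.

Let ws_mul1l : left_id ws_one ws_mul.
Proof.
move=> f; apply/funext => -[|x s]; rewrite /ws_mul.
  by rewrite splits_nil big_seq1 mul1r.
rewrite (splits_cons (fun u v => ws_one u * f v)) mul1r.
by rewrite big1 ?addr0// => p _; rewrite mul0r.
Qed.

Let ws_mul1r : right_id ws_one ws_mul.
Proof.
move=> f; apply/funext; rewrite /ws_mul.
have E s h : \sum_(p <- splits s) h p.1 * ws_one p.2 = h s.
  elim: s h => [|x s IHs] h; first by rewrite splits_nil big_seq1 mulr1.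
  rewrite (splits_cons (fun u v => h u * ws_one v)) mulr0 add0r.
  exact: (IHs (fun u => h (x :: u))).
by move=> s; exact: E.
Qed.

Let ws_mulDl : left_distributive ws_mul +%R.
Proof.
move=> f g h; apply/funext => s; rewrite [RHS]ws_addE /ws_mul -big_split /=.
by apply: eq_bigr => p _; rewrite mulrDl.
Qed.

Let ws_mulDr : right_distributive ws_mul +%R.
Proof.
move=> f g h; apply/funext => s; rewrite [RHS]ws_addE /ws_mul -big_split /=.
by apply: eq_bigr => p _; rewrite mulrDr.
Qed.

Let ws_one_neq0 : ws_one != 0.
Proof. by apply/eqP => /(congr1 (@^~ [::])) /eqP; rewrite oner_eq0. Qed.

HB.instance Definition _ := GRing.Zmodule_isNzRing.Build wordseries
  ws_mulA ws_mul1l ws_mul1r ws_mulDl ws_mulDr ws_one_neq0.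

Lemma ws_mulE f g s : (f * g) s = \sum_(p <- splits s) f p.1 * g p.2.
Proof. by []. Qed.

Definition wsX : wordseries := fun s => if s is [:: b] then b else 0.

Lemma wsX_mul f s : (wsX * f) s = if s is b :: t then b * f t else 0.
Proof.
case: s => [|b t]; first by rewrite ws_mulE splits_nil big_seq1 mul0r.
rewrite ws_mulE (splits_cons (fun u v => wsX u * f v)) mul0r add0r.
case: t => [|c t]; first by rewrite splits_nil big_seq1.
rewrite (splits_cons (fun u v => wsX (b :: u) * f v)).
by rewrite big1 ?addr0// => p _; rewrite mul0r.
Qed.

(** Congruence modulo degree n; fixed-point equations have at most one solution
    because multiplication by X gains one degree. *)
Definition ws_agree n f g := forall s, (size s < n)%N -> f s = g s.

Lemma ws_agree_eq f g : (forall n, ws_agree n f g) -> f = g.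
Proof. by move=> E; apply/funext => s; exact: (E (size s).+1). Qed.

Lemma ws_agree_mul n f f' g g' :
  ws_agree n f f' -> ws_agree n g g' -> ws_agree n (f * g) (f' * g').
Proof.
move=> Ef Eg s les; rewrite !ws_mulE.
apply: (eq_splits (h := fun u v => f u * g v) (h' := fun u v => f' u * g' v)).
move=> u v uv; rewrite Ef ?Eg //; apply: leq_ltn_trans les; rewrite -uv.
  exact: leq_addl.
exact: leq_addr.
Qed.

Lemma ws_agree_wsX_mul n f g :
  ws_agree n f g -> ws_agree n.+1 (wsX * f) (wsX * g).
Proof. by move=> E [|b t] les; rewrite !wsX_mul // E. Qed.

Lemma ws_agree_add n f f' g g' :
  ws_agree n f f' -> ws_agree n g g' -> ws_agree n (f + g) (f' + g').
Proof. by move=> Ef Eg s les; rewrite !ws_addE Ef // Eg. Qed.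

(** The difference of two solutions is divisible by arbitrarily high powers of
    X. *)
Lemma ws_linear_unique h f g k :
  f = h + wsX * k * f -> g = h + wsX * k * g -> f = g.
Proof.
move=> Ef Eg; apply: ws_agree_eq; elim=> [//|n IHn].
rewrite Ef Eg -!mulrA; apply: ws_agree_add => //.
by apply: ws_agree_wsX_mul; exact: ws_agree_mul.
Qed.

(** Substitution of g for X in f.  The empty word is never a segment, so what is
    substituted is the part of g of positive degree; substitution in X itself
    returns g when g has no constant term. *)
Definition ws_comp f g : wordseries :=
  fun s => \sum_(p <- segmentations s) f (map g p).

Definition ws_multilinear f := forall s1 s2, linear (fun x => f (s1 ++ x :: s2)).

Definition ws_shift (a : B) f : wordseries := fun s => f (a :: s).

Lemma ws_comp_nil f g : ws_comp f g [::] = f [::].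
Proof. by rewrite /ws_comp segmentations_nil big_seq1. Qed.

Lemma ws_comp_cons f g b s :
  ws_comp f g (b :: s) =
  \sum_(p <- splits s) ws_comp (ws_shift (g (b :: p.1)) f) g p.2.
Proof. by rewrite /ws_comp segmentations_cons. Qed.

Lemma ws_compDl f f' g : ws_comp (f + f') g = ws_comp f g + ws_comp f' g.
Proof. by apply/funext => s; rewrite ws_addE /ws_comp -big_split. Qed.

Lemma ws_comp0l g : ws_comp 0 g = 0.
Proof. by apply/funext => s; rewrite /ws_comp big1. Qed.

Lemma ws_compMl f f' g : ws_comp (f * f') g = ws_comp f g * ws_comp f' g.
Proof.
apply/funext => s; rewrite /ws_comp ws_mulE.
have E p : (f * f') (map g p) = \sum_(q <- splits p) f (map g q.1) * f' (map g q.2).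
  by rewrite ws_mulE splits_map big_map.
under eq_bigr do rewrite E.
rewrite (segmentations_splits (fun u v => f (map g u) * f' (map g v))).
apply: eq_bigr => p _; rewrite mulr_suml; apply: eq_bigr => q _.
by rewrite mulr_sumr.
Qed.

Lemma ws_comp_wsX g : g [::] = 0 -> ws_comp wsX g = g.
Proof.
move=> g0; apply/funext => -[|b s]; first by rewrite ws_comp_nil g0.
rewrite ws_comp_cons.
rewrite (eq_bigr (fun p => (ws_shift b g : wordseries) p.1 * ws_one p.2)).
  by rewrite -ws_mulE mulr1.
move=> p _; case: p.2 => [|c t].
  by rewrite ws_comp_nil mulr1.
rewrite ws_comp_cons mulr0 big1 // => q _.
by rewrite /ws_comp big1.
Qed.

Lemma ws_multilinear_shift a f : ws_multilinear f -> ws_multilinear (ws_shift a f).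
Proof. by move=> fml s1 s2; exact: (fml (a :: s1)). Qed.

Lemma ws_shift_linear f g s : ws_multilinear f ->
  linear (fun a => ws_comp (ws_shift a f) g s).
Proof.
move=> fml k x y; rewrite /ws_comp scaler_sumr -big_split.
by apply: eq_bigr => p _; exact: (fml [::]).
Qed.

Lemma linear_sum_fun (U V : lmodType K) (phi : U -> V) (I : Type) (r : seq I)
    (F : I -> U) :
  linear phi -> phi (\sum_(i <- r) F i) = \sum_(i <- r) phi (F i).
Proof.
move=> philin.
have phi0 : phi 0 = 0.
  by have := philin (-1) 0 0; rewrite !scaler0 !add0r scaleN1r addNr.
elim: r => [|i r IHr]; first by rewrite !big_nil.
by rewrite !big_cons -IHr -[F i]scale1r philin !scale1r.
Qed.

Lemma linear_fun0 (U V : lmodType K) (phi : U -> V) : linear phi -> phi 0 = 0.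
Proof.
by move=> philin; have := linear_sum_fun [::] (fun _ : nat => 0) philin;
  rewrite !big_nil.
Qed.

Lemma ws_comp_id f : ws_multilinear f -> ws_comp f wsX = f.
Proof.
move=> fml; apply/funext => s; elim: s f fml => [|b s IHs] f fml.
  by rewrite ws_comp_nil.
rewrite ws_comp_cons; case: s IHs => [|c s] IHs.
  by rewrite splits_nil big_seq1 ws_comp_nil.
rewrite (splits_cons (fun u v => ws_comp (ws_shift (wsX (b :: u)) f) wsX v)).
rewrite IHs; last exact: ws_multilinear_shift.
rewrite big1 ?addr0 // => p _.
exact: linear_fun0 (ws_shift_linear wsX _ fml).
Qed.

(** Induction on the length, isolating the first segment on both sides.  By
    multiplicativity the two sides run over the same refinements, and linearity
    of f in its first argument lets the sum defining [ws_comp g h] be pulled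
    out of it. *)
Lemma ws_compA f g h : ws_multilinear f ->
  ws_comp (ws_comp f g) h = ws_comp f (ws_comp g h).
Proof.
move=> fml; apply/funext => s; have [n] := ubnP (size s).
elim: n => // n IHn in s f fml *.
case: s => [|b s]; first by rewrite !ws_comp_nil.
rewrite ltnS => les; rewrite !ws_comp_cons.
transitivity (\sum_(p <- splits s) ws_comp (ws_comp
    (ws_shift (ws_comp g h (b :: p.1)) f) g) h p.2); last first.
  apply: (eq_splits (h := fun u v => ws_comp (ws_comp
    (ws_shift (ws_comp g h (b :: u)) f) g) h v) (h' := fun u v =>
    ws_comp (ws_shift (ws_comp g h (b :: u)) f) (ws_comp g h) v)) => u v uv.
  apply: IHn; first exact: ws_multilinear_shift.
  by move: les; rewrite /= -uv; apply: leq_ltn_trans; exact: leq_addl.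
(* Isolate the first segment a, on which everything depends linearly. *)
pose G a s := ws_comp (ws_comp (ws_shift a f) g) h s.
have Glin s1 : linear (G^~ s1).
  move=> k x y; rewrite /G /ws_comp scaler_sumr -big_split.
  by apply: eq_bigr => p _; exact: (ws_shift_linear g (map h p) fml).
have Gsum (I : Type) (r : seq I) s1 (F : I -> B) :
    G (\sum_(i <- r) F i) s1 = \sum_(i <- r) G (F i) s1.
  exact: (linear_sum_fun r F (Glin s1)).
transitivity (\sum_(p <- splits s) \sum_(q <- splits p.2)
    \sum_(p1 <- segmentations q.1) G (g (map h ((b :: p.1) :: p1))) q.2).
  apply: eq_bigr => p _; rewrite [LHS]/ws_comp.
  pose k u v := ws_comp (ws_shift (g (map h ((b :: p.1) :: u))) f) g (map h v).
  rewrite (eq_bigr (fun q => \sum_(r <- splits q) k r.1 r.2)); last first.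
    by move=> q _; rewrite /ws_shift ws_comp_cons splits_map big_map.
  exact: segmentations_splits.
rewrite -(splits_assoc (fun u v w => \sum_(p1 <- segmentations v)
  G (g (map h ((b :: u) :: p1))) w)).
apply: eq_bigr => p _; rewrite -[RHS]/(G _ p.2).
have -> : ws_comp g h (b :: p.1) = \sum_(q <- splits p.1)
    \sum_(p1 <- segmentations q.2) g (map h ((b :: q.1) :: p1)).
  exact: segmentations_cons.
by rewrite Gsum; apply: eq_bigr => q _; rewrite Gsum.
Qed.

End Series.
Arguments wsX {K B}.

(** * The series Phi and its composition law *)

Section Subordination.
Variables (K : fieldType) (B : algType K).
Implicit Types f g h : wordseries B.

Lemma ws_agree_comp n f g g' :
  ws_agree n g g' -> ws_agree n (ws_comp f g) (ws_comp f g').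
Proof.
move=> E s; have [m] := ubnP (size s); elim: m => // m IHm in s f *.
case: s => [|b s]; first by rewrite !ws_comp_nil.
rewrite ltnS => lem les; rewrite !ws_comp_cons.
apply: (eq_splits (h := fun u v => ws_comp (ws_shift (g (b :: u)) f) g v)
  (h' := fun u v => ws_comp (ws_shift (g' (b :: u)) f) g' v)) => u v uv.
rewrite /= -uv in lem les; rewrite E; last first.
  by apply: leq_ltn_trans les => /=; rewrite ltnS leq_addr.
apply: IHm; first by apply: leq_ltn_trans lem; exact: leq_addl.
by apply: leq_ltn_trans les; rewrite leqW // leq_addl.
Qed.

(** The right-hand side of the equation of which Phi_f is the fixed point. *)
Definition ws_step f g : wordseries B := wsX + wsX * (ws_comp f g * g).

(** The iterates of [ws_step] stabilize in each degree, so the coefficient at a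
    word can be read off after more steps than the word has letters. *)
Definition ws_arg f : wordseries B :=
  fun s => iter (size s).+1 (ws_step f) 0 s.

Lemma ws_agree_step n f g g' :
  ws_agree n g g' -> ws_agree n.+1 (ws_step f g) (ws_step f g').
Proof.
move=> E; apply: ws_agree_add => //; apply: ws_agree_wsX_mul.
by apply: ws_agree_mul => //; exact: ws_agree_comp.
Qed.

Lemma ws_argE f : ws_arg f = ws_step f (ws_arg f).
Proof.
have mono n k : ws_agree n (iter n (ws_step f) 0) (iter (n + k) (ws_step f) 0).
  by elim: n => // n IHn; exact: ws_agree_step.
have E n : ws_agree n (ws_arg f) (iter n (ws_step f) 0).
  by move=> s les; rewrite /ws_arg -(subnKC les); exact: mono.
apply/funext => s; rewrite (E (size s).+1) //; apply: ws_agree_step (ltnSn _).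
by move=> t lt; rewrite (E (size s)).
Qed.

Lemma ws_arg_unique f g : g = ws_step f g -> g = ws_arg f.
Proof.
move=> Eg; apply: ws_agree_eq; elim=> // n IHn.
by rewrite Eg ws_argE; exact: ws_agree_step.
Qed.

Lemma ws_arg_nil f : ws_arg f [::] = 0.
Proof. by rewrite ws_argE /ws_step ws_addE wsX_mul addr0. Qed.

Lemma ws_arg0 : ws_arg 0 = wsX.
Proof. by apply/esym/ws_arg_unique; rewrite /ws_step ws_comp0l mul0r mulr0 addr0. Qed.

(** With P = Phi_f, Q = Phi_{g o P} and T = P o Q, composing the equation of P
    with Q gives T = Q (1 + (f o T) T), and the equation of Q reads
    Q = X + X (g o T) Q.  Substituting the second in the first shows that T
    satisfies the equation of Phi_{g + f}. *)
Lemma ws_arg_comp f g : ws_multilinear f -> ws_multilinear g ->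
  ws_comp (ws_arg f) (ws_arg (ws_comp g (ws_arg f))) = ws_arg (g + f).
Proof.
move=> fml gml; set P := ws_arg f; set Q := ws_arg _.
apply: ws_arg_unique; set T := ws_comp P Q.
have ET : T = Q * (1 + ws_comp f T * T).
  rewrite {1}/T {1}/P ws_argE /ws_step -/P ws_compDl !ws_compMl ws_compA //.
  by rewrite !(ws_comp_wsX (ws_arg_nil _)) mulrDr mulr1.
have EQ : Q = wsX + wsX * (ws_comp g T * Q).
  by rewrite {1}/Q ws_argE /ws_step -/Q ws_compA.
rewrite {1}ET {1}EQ mulrDl -!mulrA -ET /ws_step ws_compDl !mulrDl !mulrDr mulr1.
by rewrite -addrA; congr (_ + _); rewrite addrC.
Qed.

End Subordination.

(** * Summing over all ways to complete a string *)

Section ParseSum.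
Variables (K : fieldType) (B : algType K).

Definition ser_word (F : ser B) : wordseries B := fun s => F _ (in_tuple s).

Lemma ser_word_nil (F : ser B) : F _ [tuple] = ser_word F [::].
Proof. by congr (F _ _); exact: val_inj. Qed.

Lemma ser_word_multilinear F : ws_multilinear (ser_word F).
Proof. by move=> s1 s2; apply: (@ser_linear _ _ F s1 s2 id). Qed.

(** The series that remains to be applied once the arguments in a have been
    completed. *)
Definition ser_append (F : ser B) (a : seq B) : wordseries B :=
  fun s => ser_word F (a ++ s).

Lemma ser_append_multilinear F a : ws_multilinear (ser_append F a).
Proof.
by move=> s1 s2 k x y; rewrite /ser_append !catA; exact: ser_word_multilinear.
Qed.

Lemma ser_append_rcons F a c : ser_append F (rcons a c) = ws_shift c (ser_append F a).
Proof. by apply/funext => s; rewrite /ser_append cat_rcons. Qed.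

(** The argument being read already carries the factor x on its left.  The
    value at the empty word is 0 because that argument must receive a letter
    before the block can close. *)
Definition ws_scale_first (x : B) (f : wordseries B) : wordseries B :=
  fun s => if s is c :: t then f (x * c :: t) else 0.

Lemma ws_scale_first_sum f g x s : ws_multilinear f -> g [::] = 0 ->
  ws_comp (ws_scale_first x f) g s =
  \sum_(p <- splits s) ws_comp (ws_shift (x * g p.1) f) g p.2.
Proof.
move=> fml g0; have C0 v := linear_fun0 (ws_shift_linear g v fml).
case: s => [|c s]; first by rewrite ws_comp_nil splits_nil big_seq1 g0 mulr0 C0.
rewrite (splits_cons (fun u v => ws_comp (ws_shift (x * g u) f) g v)).
by rewrite g0 mulr0 C0 add0r ws_comp_cons.
Qed.

(** The contents of the current argument starting with the letter b: either b is
    the whole content, and the next arguments follow, or b is followed by a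
    nested block, which multiplies the factor on the left.  This is the equation
    of [ws_arg g] inserted in the first argument of f. *)
Lemma ws_scale_first_arg f g x b s : ws_multilinear f ->
  ws_comp (ws_scale_first x f) (ws_arg g) (b :: s) =
  ws_comp (ws_shift (x * b) f) (ws_arg g) s +
  \sum_(p <- splits s)
    ws_comp (ws_scale_first (x * b * ws_comp g (ws_arg g) p.1) f) (ws_arg g) p.2.
Proof.
move=> fml; set P := ws_arg g; set D := ws_comp g P.
pose C c v := ws_comp (ws_shift c f) P v.
have Clin v : linear (C^~ v) := ws_shift_linear P v fml.
have Csum I (r : seq I) v F : C (\sum_(i <- r) F i) v = \sum_(i <- r) C (F i) v.
  exact: (linear_sum_fun r F (Clin v)).
have CD v c c' : C (c + c') v = C c v + C c' v.
  by have := Clin v 1 c c'; rewrite !scale1r.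
rewrite ws_comp_cons.
rewrite (eq_bigr (fun p => C (x * b * ws_one p.1) p.2 +
    \sum_(q <- splits p.1) C (x * b * D q.1 * P q.2) p.2)); last first.
  move=> p _; rewrite -[LHS]/(C (x * P (b :: p.1)) p.2).
  rewrite {1}/P ws_argE /ws_step -/P -/D ws_addE wsX_mul ws_mulE mulrDr CD.
  congr (_ + _); first by case: p.1 => [|? ?]; rewrite ?mulr1 ?mulr0.
  by rewrite !mulr_sumr Csum; apply: eq_bigr => q _; rewrite !mulrA.
rewrite big_split; congr (_ + _).
  case: s => [|c s]; first by rewrite splits_nil big_seq1 mulr1.
  rewrite (splits_cons (fun u v => C (x * b * ws_one u) v)) mulr1 big1 ?addr0 //.
  by move=> p _; rewrite mulr0 (linear_fun0 (Clin _)).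
rewrite (splits_assoc (fun u v w => C (x * b * D u * P v) w)).
by apply: eq_bigr => p _; rewrite ws_scale_first_sum //; exact: ws_arg_nil.
Qed.

Variables G0 G : ser B.

Definition next_ser (st : seq (frame B)) : ser B := if st is [::] then G0 else G.

(** The sum of the values of all balanced strings that complete the state st and
    have s as the remaining elements of B.  A block opened when the stack is
    empty uses G0, any other one uses G; commas and closing parentheses are only
    offered when some parenthesis is open. *)
Fixpoint parse_sum (st : B * seq (frame B)) (s : seq B) : B :=
  if s is b :: s' then
    let st1 := read_symbol st (SArg b) in
    let H := next_ser st.2 in
    parse_sum (read_symbol st1 (SSingle H)) s' +
    parse_sum (read_symbol st1 (SOpen H)) s' +
    (if st.2 is [::] then 0 else
     parse_sum (read_symbol st1 (SComma B)) s' +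
     parse_sum (read_symbol st1 (SClose B)) s')
  else if st is (x, [::]) then x else 0.

Lemma parse_sum_cons st b s :
  parse_sum st (b :: s) =
  parse_sum (read_symbol (read_symbol st (SArg b)) (SSingle (next_ser st.2))) s +
  parse_sum (read_symbol (read_symbol st (SArg b)) (SOpen (next_ser st.2))) s +
  (if st.2 is [::] then 0 else
   parse_sum (read_symbol (read_symbol st (SArg b)) (SComma B)) s +
   parse_sum (read_symbol (read_symbol st (SArg b)) (SClose B)) s).
Proof. by []. Qed.

(** Linearity with respect to any of the elements stored in the state; the
    choice of the next symbol depends only on the height of the stack, which is
    constant along such a family. *)
Lemma parse_sum_linear (f : B -> B * seq (frame B)) s :
  hot_state f -> linear (fun x => parse_sum (f x) s).
Proof.
elim: s f => [|b s IHs] f hotf.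
  have lin0 : linear (fun _ : B => 0 : B) by move=> k x y; rewrite scaler0 addr0.
  by case: hotf => [g [|? ?] gl|a g F s [|? ?] ? _|a y F g s1 s2 [|? ?] ? _] //=.
have hotb := hot_read_symbol (SArg b) hotf.
have hot w : linear (fun x => parse_sum (read_symbol (read_symbol (f x) (SArg b)) w) s).
  exact: IHs (hot_read_symbol w hotb).
have [n nE] : exists n, forall x, size (f x).2 = n.
  case: hotf => [g st _|a g F t st1 st2 _|a y F g s1 s2 st1 st2 _].
  - by exists (size st).
  - by exists (size (st1 ++ (0, F, t) :: st2)) => x; rewrite !size_cat.
  - by exists (size (st1 ++ (y, F, [::]) :: st2)) => x; rewrite !size_cat.
case: n nE => [|n] nE.
  have E x : (f x).2 = [::] by apply/eqP; rewrite -size_eq0 nE.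
  by move=> k x y; rewrite !parse_sum_cons !E !addr0 !hot scalerDr addrACA.
have E x : next_ser (f x).2 = G by move: (nE x); case: (f x).2.
have E' x u v : (if (f x).2 is [::] then u else v) = v :> B.
  by move: (nE x); case: (f x).2.
move=> k x y; rewrite !parse_sum_cons !E !E' !hot !scalerDr.
set p1 := k *: _; set q1 := parse_sum _ s; set p2 := k *: _.
by rewrite (addrACA p1) (addrACA (k *: _) _ (k *: _)) (addrACA (p1 + p2)).
Qed.

Lemma parse_sum_mul y st s : linear (fun x => parse_sum (y * x, st) s).
Proof.
apply: (@parse_sum_linear (fun x => (y * x, st))); apply: hot_cur.
exact: (@linear_mull _ _ id).
Qed.

Let P := ws_arg (ser_word G).

(** The arguments of F still to be read may be absent, when the block is closed
    at once, or present; together the two cases form a full composition.  The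
    hypothesis is the conclusion of [parse_sum_frame] at the word s, so that
    this step can be used inside its induction. *)
Lemma parse_sum_open F a y st s :
  (forall y a st, parse_sum (1, (y, F, a) :: st) s = \sum_(p <- splits s)
     parse_sum (y * ws_comp (ws_scale_first 1 (ser_append F a)) P p.1, st) p.2) ->
  parse_sum (y * ser_word F a, st) s + parse_sum (1, (y, F, a) :: st) s =
  \sum_(p <- splits s) parse_sum (y * ws_comp (ser_append F a) P p.1, st) p.2.
Proof.
move=> ->; case: s => [|b s].
  rewrite splits_nil !big_seq1 !ws_comp_nil {2}/ser_append cats0.
  by rewrite (linear_fun0 (parse_sum_mul y _ _)) addr0.
pose h f u v := parse_sum (y * ws_comp f P u, st) v.
rewrite (splits_cons (h (ws_scale_first 1 (ser_append F a)))).
rewrite (splits_cons (h (ser_append F a))) /h !ws_comp_nil -[ser_append F a [::]]/(ser_word F (a ++ [::])) cats0.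
rewrite (linear_fun0 (parse_sum_mul y _ _)) add0r; congr (_ + _).
apply: eq_bigr => p _; congr (parse_sum (y * _, st) _).
rewrite !ws_comp_cons; apply: eq_bigr => q _; congr (ws_comp _ _ _).
by apply/funext => t; rewrite /ws_shift /= mul1r.
Qed.

(** The word is cut where the innermost open block closes: before the cut, its
    remaining arguments are filled; after it, parsing goes on with one
    parenthesis less.  The four choices of the next symbol match the two terms
    of [ws_scale_first_arg]: comma and closing parenthesis end the current
    argument, a singleton or a new block prolongs it. *)
Lemma parse_sum_frame x y F a st s :
  parse_sum (x, (y, F, a) :: st) s = \sum_(p <- splits s)
    parse_sum (y * ws_comp (ws_scale_first x (ser_append F a)) P p.1, st) p.2.
Proof.
have [n] := ubnP (size s); elim: n => // n IHn in s x y F a st *.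
have lin0 st1 s1 := linear_fun0 (parse_sum_mul y st1 s1).
case: s => [|b s]; first by rewrite splits_nil big_seq1 ws_comp_nil lin0.
rewrite ltnS => les.
pose h u v := parse_sum (y * ws_comp (ws_scale_first x (ser_append F a)) P u, st) v.
rewrite (splits_cons h) {1}/h ws_comp_nil lin0 add0r {}/h.
have Fml := ser_append_multilinear F a.
under [RHS]eq_bigr do rewrite (ws_scale_first_arg _ _ _ _ Fml).
have linD st1 s1 u v : parse_sum (y * (u + v), st1) s1 =
    parse_sum (y * u, st1) s1 + parse_sum (y * v, st1) s1.
  by have := parse_sum_mul y st1 s1 1 u v; rewrite !scale1r.
under [RHS]eq_bigr do rewrite linD.
rewrite big_split [RHS]addrC parse_sum_cons /=; congr (_ + _); last first.
  rewrite addrC -(ser_append_rcons F a (x * b)) -parse_sum_open // => *.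
  exact: IHn.
rewrite ser_word_nil parse_sum_open; last by move=> *; exact: IHn.
rewrite [RHS](eq_bigr (fun p => \sum_(q <- splits p.1) parse_sum (y * ws_comp
    (ws_scale_first (x * b * ws_comp (ser_word G) P q.1) (ser_append F a)) P q.2,
    st) p.2)); last first.
  by move=> p _; exact: (linear_sum_fun _ _ (parse_sum_mul y st p.2)).
rewrite (splits_assoc (fun u v w => parse_sum (y * ws_comp
    (ws_scale_first (x * b * ws_comp (ser_word G) P u) (ser_append F a)) P v, st) w)).
pose k u v := parse_sum (x * b * ws_comp (ser_append G [::]) P u, (y, F, a) :: st) v.
apply: (eq_splits (h := k) (h' := fun u v => \sum_(q <- splits v)
  parse_sum (y * ws_comp
    (ws_scale_first (x * b * ws_comp (ser_word G) P u) (ser_append F a)) P q.1, st) q.2)).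
move=> u v uv; rewrite /k IHn //.
by move: les; rewrite /= -uv; apply: leq_ltn_trans; exact: leq_addl.
Qed.

Lemma parse_sum_block H y st s :
  parse_sum (y * ser_word H [::], st) s + parse_sum (1, (y, H, [::]) :: st) s =
  \sum_(p <- splits s) parse_sum (y * ws_comp (ser_word H) P p.1, st) p.2.
Proof. by rewrite parse_sum_open // => *; exact: parse_sum_frame. Qed.

(** What may follow once all parentheses are closed: the series Y of the
    decomposition. *)
Definition ws_tail : wordseries B := fun s => parse_sum (1, [::]) s.

Lemma parse_sum_nil x s : parse_sum (x, [::]) s = x * ws_tail s.
Proof.
have [n] := ubnP (size s); elim: n => // n IHn in s x *.
case: s => [|b s]; first by rewrite /ws_tail /= mulr1.
rewrite ltnS => les; rewrite /ws_tail /= !addr0 mul1r.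
rewrite ser_word_nil !parse_sum_block mulr_sumr.
pose D := ws_comp (ser_word G0) P.
apply: (eq_splits (h := fun u v => parse_sum (x * b * D u, [::]) v)
  (h' := fun u v => x * parse_sum (b * D u, [::]) v)) => u v uv.
have lev : (size v < n)%N by move: les; rewrite /= -uv; apply: leq_ltn_trans; exact: leq_addl.
by rewrite IHn // [in RHS]IHn // !mulrA.
Qed.

Lemma ws_tailE : ws_tail = 1 + wsX * ws_comp (ser_word G0) P * ws_tail.
Proof.
apply/funext => s; rewrite ws_addE -mulrA wsX_mul.
case: s => [|b s]; first by rewrite addr0.
rewrite add0r /ws_tail /= addr0 mul1r.
rewrite ser_word_nil !parse_sum_block ws_mulE mulr_sumr.
by apply: eq_bigr => p _; rewrite [LHS]parse_sum_nil mulrA.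
Qed.

(** The first symbol opens a block of F or is a singleton block of F. *)
Lemma parse_sum_first F s :
  parse_sum (ser_word F [::], [::]) s + parse_sum (1, [:: (1, F, [::])]) s =
  (ws_comp (ser_word F) P * ws_tail) s.
Proof.
have := parse_sum_block F 1 [::] s; rewrite mul1r => ->.
by apply: eq_bigr => p _; rewrite mul1r parse_sum_nil.
Qed.

End ParseSum.

(** * Words of block marks *)

Section Words.

(** A letter records whether a point is the minimum, and whether it is the
    maximum, of its block. *)
Fixpoint words (n : nat) : seq (seq (bool * bool)) :=
  if n is m.+1 then
    [seq c :: w | c <- [:: (true, true); (true, false); (false, false); (false, true)],
                  w <- words m]
  else [:: [::]].

(** Validity when h blocks are open: a point that is not a minimum needs an open
    block, and at the end all blocks are closed. *)
Fixpoint valid (h : nat) (w : seq (bool * bool)) : bool :=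
  if w is c :: w' then (c.1 || (0 < h)%N) && valid (h + c.1 - c.2) w' else h == 0%N.

Lemma mem_words n w : (w \in words n) = (size w == n).
Proof.
elim: n w => [|n IHn] w; first by rewrite inE size_eq0.
apply/allpairsP/idP => [[[c v] /= [_ vn ->]]|].
  by rewrite /= eqSS -IHn.
case: w => // c w; rewrite eqSS -IHn => wn; exists (c, w); split=> //.
by case: c => -[] [].
Qed.

Lemma uniq_words n : uniq (words n).
Proof.
elim: n => // n IHn; apply: allpairs_uniq => //.
by move=> [c w] [c' w'] _ _ [-> ->].
Qed.

Lemma big_words_cons (V : nmodType) n (f : seq (bool * bool) -> V) :
  \sum_(w <- words n.+1) f w =
  \sum_(w <- words n) f ((true, true) :: w) +
  \sum_(w <- words n) f ((true, false) :: w) +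
  (\sum_(w <- words n) f ((false, false) :: w) +
   \sum_(w <- words n) f ((false, true) :: w)).
Proof. by rewrite /= cats0 !big_cat !big_map /= addrA. Qed.

(** The open blocks, each represented by its minimum, innermost first.  A point
    that is a minimum is pushed, and a maximum pops the block to which it
    belongs, which in a non-crossing partition is the innermost one. *)
Fixpoint stack_before (L : nat -> bool * bool) (m : nat) : seq nat :=
  if m is k.+1 then
    let st := if (L k).1 then k :: stack_before L k else stack_before L k in
    if (L k).2 then behead st else st
  else [::].

Definition stack_at L m :=
  if (L m).1 then m :: stack_before L m else stack_before L m.

(** The minimum of the block to which point m is assigned; 0 stands for the case
    of an empty stack, which does not occur on valid words. *)
Definition opener L m := head 0%N (stack_at L m).

Lemma stack_beforeS L m :
  stack_before L m.+1 = if (L m).2 then behead (stack_at L m) else stack_at L m.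
Proof. by []. Qed.

Definition complete L N :=
  (forall m, (m < N)%N -> stack_at L m <> [::]) /\ stack_before L N = [::].

Lemma size_stack_beforeS L m : stack_at L m <> [::] ->
  size (stack_before L m.+1) = (size (stack_before L m) + (L m).1 - (L m).2)%N.
Proof.
rewrite stack_beforeS /stack_at; case: (L m) => -[] [] /=;
  by rewrite ?size_behead ?addn1 ?addn0 ?subn1 ?subn0.
Qed.

Lemma valid_stack L m k :
  valid (size (stack_before L m)) [seq L i | i <- iota m k] <->
  (forall i, (m <= i < m + k)%N -> stack_at L i <> [::]) /\
  stack_before L (m + k) = [::].
Proof.
elim: k m => [|k IHk] m.
  rewrite /= addn0 size_eq0; split=> [/eqP ->|[_ ->]] //; split=> // i.
  by case/andP=> /leq_ltn_trans h /h; rewrite ltnn.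
have E : ((L m).1 || (0 < size (stack_before L m))%N) <-> stack_at L m <> [::].
  by rewrite /stack_at; case: (L m) => -[] c //=; case: (stack_before L m).
rewrite [X in X <-> _]/=; split=> [/andP[/E nz]|[nz st0]].
  rewrite -size_stack_beforeS // addnS -addSn => /IHk[nz' st0]; split=> // i.
  by rewrite leq_eqVlt => /andP[/orP[/eqP <- //|lt] lt']; apply: nz'; rewrite lt.
have nzm : stack_at L m <> [::] by apply: nz; rewrite leqnn addnS ltnS leq_addr.
apply/andP; split; first exact/E.
rewrite -size_stack_beforeS //; apply/IHk; rewrite addSn -addnS; split=> // i.
by case/andP=> lt lt'; apply: nz; rewrite (ltnW lt).
Qed.

Lemma valid_complete L N : valid 0 [seq L i | i <- iota 0 N] <-> complete L N.
Proof.
have := valid_stack L 0 N; rewrite add0n => ->.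
by split=> -[h ?]; split=> // m lt; apply: h; rewrite ?lt // ?andbT.
Qed.

Lemma stack_before_bound L m a : a \in stack_before L m -> (a < m)%N /\ (L a).1.
Proof.
elim: m => // m IHm; rewrite stack_beforeS => am.
have {am} : a \in stack_at L m by case: ifP am => // _ /mem_behead.
rewrite /stack_at; case: ifP => Lm; last by case/IHm => /leqW.
by rewrite inE => /orP[/eqP -> //|/IHm[/leqW]].
Qed.

Lemma stack_at_bound L m a : a \in stack_at L m -> (a <= m)%N /\ (L a).1.
Proof.
rewrite /stack_at; case: ifP => Lm; last by case/stack_before_bound => /ltnW.
by rewrite inE => /orP[/eqP -> //|/stack_before_bound[/ltnW]].
Qed.

Lemma stack_at_sorted L m : sorted gtn (stack_at L m).
Proof.
have push k : sorted gtn (stack_before L k) -> sorted gtn (stack_at L k).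
  rewrite /stack_at => srt; case: ifP => // _.
  rewrite /= path_min_sorted //; apply/allP => a.
  by case/stack_before_bound.
apply: (push); elim: m => // m /push; rewrite stack_beforeS.
by case: ifP => // _; case: stack_at => //= a s; exact: path_sorted.
Qed.

Lemma opener_max L m a : a \in stack_at L m -> (a <= opener L m)%N.
Proof.
rewrite /opener; have := stack_at_sorted L m; case: stack_at => // h s /=.
rewrite (path_sortedE (rev_trans ltn_trans)) => /andP[/allP hs _].
by rewrite inE => /orP[/eqP -> //|/hs /ltnW].
Qed.

Lemma opener_mem L m : stack_at L m <> [::] -> opener L m \in stack_at L m.
Proof. by rewrite /opener; case: stack_at => // h s _; exact: mem_head. Qed.

Lemma mem_behead_stack L m a :
  (a \in behead (stack_at L m)) = (a \in stack_at L m) && (a != opener L m).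
Proof.
rewrite /opener; have := stack_at_sorted L m; case: stack_at => // h s.
move=> /= srt; have : uniq (h :: s).
  by apply: (@sorted_uniq _ gtn (rev_trans ltn_trans) ltnn (h :: s)).
rewrite inE => /= /andP[hs _]; case: eqP => [->|_]; last by rewrite andbT.
by rewrite (negbTE hs).
Qed.

Lemma mem_stack_beforeS L m a :
  (a \in stack_before L m.+1) =
  (a \in stack_at L m) && ((L m).2 ==> (a != opener L m)).
Proof.
by rewrite stack_beforeS; case: ifP => _; rewrite ?mem_behead_stack ?andbT.
Qed.

(** A block that has been closed is never reopened. *)
Lemma stack_at_old L s t a :
  a \in stack_at L t -> (a < s <= t)%N -> a \in stack_before L s.
Proof.
elim: t => [|t IHt] at_t /andP[ltas lest].
  by move: lest ltas; rewrite leqn0 => /eqP ->.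
move: at_t; rewrite {1}/stack_at.
have at_b : a \in stack_before L t.+1 -> a \in stack_before L s.
  move: lest; rewrite leq_eqVlt => /orP[/eqP -> //|lest].
  by rewrite mem_stack_beforeS => /andP[/IHt-> //]; rewrite ltas.
case: ifP => // _; rewrite inE => /orP[/eqP E|//].
by move: (leq_trans ltas lest); rewrite E ltnn.
Qed.

(** A non-crossing partition of the integers below N, presented by the map that
    sends a point to the minimum of its block. *)
Definition ncmap (N : nat) (f : nat -> nat) : Prop :=
  [/\ forall j, (j < N)%N -> (f j <= j)%N,
      forall j, (j < N)%N -> f (f j) = f j
    & forall i j k l, (i < j)%N -> (j < k)%N -> (k < l)%N -> (l < N)%N ->
        f i = f k -> f j = f l -> f i = f j].

(** L marks the minima and the maxima of the partition presented by f. *)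
Definition codes (N : nat) (f : nat -> nat) (L : nat -> bool * bool) : Prop :=
  forall m, (m < N)%N ->
    ((L m).1 <-> f m = m) /\
    ((L m).2 <-> forall j, (m < j < N)%N -> f j <> f m).

(** From words to partitions.  Two crossing blocks would both have to be on top of
    the stack at intermediate points, whereas the stack is sorted; and a block
    that is never popped would still be there at the end, so a point that is not
    marked as a maximum has a later point in its block. *)
Lemma opener_ncmap L N : complete L N -> ncmap N (opener L) /\ codes N (opener L) L.
Proof.
case=> nz st0.
have mem m : (m < N)%N -> opener L m \in stack_at L m by move/nz/opener_mem.
have le m : (m < N)%N -> (opener L m <= m)%N by case/mem/stack_at_bound.
have fix_ a : (L a).1 -> opener L a = a by rewrite /opener /stack_at => ->.
split; first split=> //.
- by move=> j /mem/stack_at_bound[_ /fix_].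
- move=> i j k l ij jk kl lN Eik Ejl.
  have kN := ltn_trans kl lN; have jN := ltn_trans jk kN; have iN := ltn_trans ij jN.
  apply/eqP; rewrite eqn_leq; apply/andP; split.
    apply: opener_max; rewrite /stack_at.
    have : opener L i \in stack_before L j.
      apply: (@stack_at_old _ _ k); first by rewrite Eik mem.
      by rewrite (leq_ltn_trans (le _ iN) ij) ltnW.
    by case: ifP => // _; rewrite inE orbC => ->.
  rewrite Eik; apply: opener_max; rewrite /stack_at.
  have : opener L j \in stack_before L k.
    apply: (@stack_at_old _ _ l); first by rewrite Ejl mem.
    by rewrite (leq_ltn_trans (le _ jN) jk) ltnW.
  by case: ifP => // _; rewrite inE orbC => ->.
move=> m mN; split.
  by split=> [/fix_ //|E]; have := mem _ mN; case/stack_at_bound; rewrite E.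
split=> [Lm j /andP[mj jN] E|H].
  have : opener L m \in stack_before L m.+1.
    by apply: (@stack_at_old _ _ j); [rewrite -E mem | rewrite ltnS le].
  by rewrite mem_stack_beforeS Lm eqxx andbF.
apply/negPn/negP => Lm.
have : opener L m \in stack_before L N.
  suff S d : (m.+1 + d <= N)%N -> opener L m \in stack_before L (m.+1 + d).
    by have := S (N - m.+1)%N; rewrite subnKC // => /(_ (leqnn _)).
  elim: d => [_|d IHd]; first by rewrite addn0 mem_stack_beforeS (negbTE Lm) mem.
  rewrite addnS => ltN; rewrite mem_stack_beforeS; apply/andP; split.
    by have := IHd (ltnW ltN); rewrite /stack_at; case: ifP => // _; rewrite inE orbC => ->.
  by apply/implyP => _; apply/eqP => /esym; apply: H; rewrite ltN andbT addSn ltnS leq_addr.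
by rewrite st0.
Qed.

(** From partitions to words: reading the marks of a non-crossing partition, the
    stack consists of the minima of the blocks that have points on both sides. *)
Section NcmapStack.
Variables (L : nat -> bool * bool) (N : nat) (f : nat -> nat).
Hypotheses (fnc : ncmap N f) (fcodes : codes N f L).

Let stack_spec m := forall a,
  a \in stack_before L m <-> exists j, [/\ (m <= j < N)%N, f j = a & (a < m)%N].

Let stack_at_spec m : (m < N)%N -> stack_spec m -> forall a,
  a \in stack_at L m <-> exists j, [/\ (m <= j < N)%N, f j = a & (a <= m)%N].
Proof.
case: fnc => le_f idem _ mN IHm a; case: (fcodes mN) => L1 _.
split=> [am|[j [/andP[mj jN] fj]]].
  have : (L m).1 && (a == m) \/ a \in stack_before L m.
    move: am; rewrite /stack_at; case: ifP => _; last by right.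
    by rewrite inE => /orP[|]; [left|right].
  case=> [/andP[/L1 fm /eqP ->]|/IHm[j [jN fj /ltnW]]]; last by exists j.
  by exists m; rewrite leqnn mN fm.
rewrite leq_eqVlt => /orP[/eqP am|am].
  have Lm : (L m).1 by apply/L1; rewrite -am -fj idem.
  by rewrite /stack_at Lm am mem_head.
have : a \in stack_before L m by apply/IHm; exists j; rewrite mj jN.
by rewrite /stack_at; case: ifP => // _; rewrite inE orbC => ->.
Qed.

(** The minimum of the block of m is on the stack; if another minimum were above
   it, its block would cross the block of m. *)
Let opener_spec m : (m < N)%N -> stack_spec m -> opener L m = f m.
Proof.
move=> mN IHm; have S := stack_at_spec mN IHm.
case: fnc => le_f idem nc.
have fm_in : f m \in stack_at L m by apply/S; exists m; rewrite leqnn mN le_f.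
have /opener_mem/S[j [/andP[mj jN] fj le_om]] : stack_at L m <> [::].
  by case: stack_at fm_in.
have := opener_max fm_in; rewrite leq_eqVlt => /orP[/eqP //|lt].
have ltom : (opener L m < m)%N.
  rewrite ltn_neqAle le_om andbT; apply: contraTneq lt => E.
  by rewrite -{1}E -fj idem // fj ltnn.
have ltmj : (m < j)%N.
  by rewrite ltn_neqAle mj andbT; apply: contraTneq lt => E; rewrite {1}E fj ltnn.
have := nc _ _ _ _ lt ltom ltmj jN; rewrite idem // -fj idem // => -> //.
Qed.

Lemma ncmap_stack_before m : (m <= N)%N -> stack_spec m.
Proof.
elim: m => [|m IHm] mN a.
  by rewrite in_nil; split=> // -[j []].
have {}IHm := IHm (ltnW mN).
rewrite mem_stack_beforeS opener_spec //; case: (fcodes mN) => _ L2.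
split=> [/andP[/stack_at_spec-/(_ mN IHm)[j [/andP[mj jN] fj am]] nL]|].
  move: mj; rewrite leq_eqVlt => /orP[/eqP E|mj]; last by exists j; rewrite mj jN.
  move: nL; rewrite -fj -E eqxx implybF => /negP nL.
  apply: contrapT => H; apply: nL; apply/L2 => k /andP[mk kN] fk.
  by apply: H; exists k; split=> //; [rewrite mk kN | rewrite {1}E fj].
case=> j [/andP[mj jN] fj am]; apply/andP; split.
  by apply/stack_at_spec => //; exists j; rewrite (ltnW mj) jN.
by apply/implyP => /L2 H; apply/eqP => E; apply: (H j); rewrite ?mj // fj E.
Qed.

Lemma opener_ncmapE m : (m < N)%N -> opener L m = f m.
Proof. by move=> mN; apply: opener_spec => //; exact: ncmap_stack_before (ltnW _). Qed.

Lemma ncmap_complete : complete L N.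
Proof.
split=> [m mN|].
  have : f m \in stack_at L m.
    apply/stack_at_spec => //; first exact: ncmap_stack_before (ltnW _).
    by exists m; rewrite leqnn mN; case: fnc => ->.
  by case: stack_at.
case E : (stack_before L N) => [//|a s].
have /ncmap_stack_before[//|j [/andP[Nj]]] : a \in stack_before L N.
  by rewrite E mem_head.
by rewrite ltnNge Nj.
Qed.

Lemma ncmap_stack_nilP m : (m < N)%N ->
  stack_before L m <> [::] <-> exists i j, [/\ (i < m)%N, (m <= j < N)%N & f i = f j].
Proof.
case: fnc => le_f idem _ mN; have S := ncmap_stack_before (ltnW mN).
split=> [|[i [j [im /andP[mj jN] fij]]] st0].
  case E : stack_before => [//|a s] _.
  have /S[j [mj fj am]] : a \in stack_before L m by rewrite E mem_head.
  exists a, j; split=> //; rewrite -fj idem //; by case/andP: mj.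
have : f j \in stack_before L m.
  apply/S; exists j; rewrite mj jN; split=> //.
  by rewrite -fij (leq_ltn_trans (le_f i _)) // (ltn_trans im).
by rewrite st0.
Qed.

End NcmapStack.

End Words.

(** * Non-crossing partitions as words *)

Section PartitionWord.
Variable n : nat.
Implicit Types P Q : {set {set 'I_n.+1}}.

Definition is_min P (m : 'I_n.+1) : bool := [forall j in finset.pblock P m, (m <= j)%N].
Definition is_max P (m : 'I_n.+1) : bool := [forall j in finset.pblock P m, (j <= m)%N].

Definition letter P (m : 'I_n.+1) : bool * bool := (is_min P m, is_max P m).

Definition word P : seq (bool * bool) := [seq letter P m | m <- enum 'I_n.+1].

Definition block_min P (m : 'I_n.+1) : 'I_n.+1 :=
  [arg min_(j < m in finset.pblock P m) (j : nat)].

Definition min_map P (m : nat) : nat := block_min P (inord m).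
Definition letters_of P (m : nat) : bool * bool := letter P (inord m).

Lemma word_iota P : word P = [seq letters_of P m | m <- iota 0 n.+1].
Proof.
rewrite /word -val_enum_ord -map_comp; apply: eq_map => i.
by rewrite /letters_of /= inord_val.
Qed.

Section Partition.
Variables (P : {set {set 'I_n.+1}}) (partP : finset.partition P [set: 'I_n.+1]).

Lemma mem_block i : i \in finset.pblock P i.
Proof. by rewrite mem_pblock (cover_partition partP) finset.in_setT. Qed.

Lemma same_blockE i j :
  (finset.pblock P i == finset.pblock P j) = (j \in finset.pblock P i).
Proof.
by rewrite eq_pblock ?(partition_trivIset partP) // (cover_partition partP) finset.in_setT.
Qed.

Lemma block_min_in i : block_min P i \in finset.pblock P i.
Proof. by rewrite /block_min; case: arg_minnP; rewrite ?mem_block. Qed.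

Lemma block_min_le i j : j \in finset.pblock P i -> (block_min P i <= j)%N.
Proof. by rewrite /block_min; case: arg_minnP; rewrite ?mem_block // => k _; apply. Qed.

Lemma block_min_eq i j :
  (block_min P i == block_min P j) = (finset.pblock P i == finset.pblock P j).
Proof.
apply/eqP/eqP => [E|E].
  apply/eqP; have := block_min_in i; rewrite -same_blockE => /eqP ->.
  by have := block_min_in j; rewrite E -same_blockE eq_sym.
apply/val_inj/eqP; rewrite eqn_leq !block_min_le //.
  by rewrite -E block_min_in.
by rewrite E block_min_in.
Qed.

Lemma min_map_val (i : 'I_n.+1) : min_map P i = block_min P i.
Proof. by rewrite /min_map inord_val. Qed.

Lemma min_map_eq (i j : 'I_n.+1) :
  min_map P i = min_map P j <-> finset.pblock P i = finset.pblock P j.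
Proof.
rewrite !min_map_val; split=> [/val_inj E|E].
  by apply/eqP; rewrite -block_min_eq E.
by congr val; apply/eqP; rewrite block_min_eq E.
Qed.

Lemma is_minP (m : 'I_n.+1) : is_min P m <-> min_map P m = m.
Proof.
rewrite min_map_val; split=> [/forall_inP h|h].
  by apply/eqP; rewrite eqn_leq block_min_le ?mem_block // h // block_min_in.
by apply/forall_inP => j jm; rewrite -h block_min_le.
Qed.

Lemma min_map_codes : codes n.+1 (min_map P) (letters_of P).
Proof.
move=> m mN; pose i := Ordinal mN.
rewrite (_ : letters_of P m = letter P i); last first.
  by rewrite -[m]/(val i) /letters_of inord_val.
rewrite -[m]/(val i); split; first exact: is_minP.
split=> [/forall_inP h j /andP[ij jN]|h].
  move=> /(min_map_eq (Ordinal jN))/eqP; rewrite eq_sym same_blockE => /h.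
  by rewrite leqNgt ij.
apply/forall_inP => j; rewrite -same_blockE => /eqP /min_map_eq E.
by rewrite leqNgt; apply/negP => ij; apply: (h j) => //; rewrite ij ltn_ord.
Qed.

Lemma min_map_ncmap : noncrossing P -> ncmap n.+1 (min_map P).
Proof.
move=> /forall_inP nc; split.
- by move=> j jN; rewrite -[j]/(val (Ordinal jN)) min_map_val block_min_le ?mem_block.
- move=> j jN; rewrite -[j]/(val (Ordinal jN)) [X in min_map P X]min_map_val.
  apply/min_map_eq/eqP; rewrite eq_sym same_blockE; exact: block_min_in.
move=> i j k l ij jk kl lN.
have kN := ltn_trans kl lN; have jN := ltn_trans jk kN; have iN := ltn_trans ij jN.
move=> /(min_map_eq (Ordinal iN) (Ordinal kN)) Eik.
move=> /(min_map_eq (Ordinal jN) (Ordinal lN)) Ejl.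
apply/(min_map_eq (Ordinal iN) (Ordinal jN)).
have PV x : finset.pblock P x \in P.
  by rewrite pblock_mem // (cover_partition partP) finset.in_setT.
have /forall_inP/(_ _ (PV (Ordinal jN))) := nc _ (PV (Ordinal iN)).
move=> /forall_inP/(_ _ (mem_block _))/forall_inP/(_ _ (mem_block _)).
move=> /forall_inP/(_ (Ordinal kN)); rewrite Eik mem_block => /(_ isT).
move=> /forall_inP/(_ (Ordinal lN)); rewrite Ejl mem_block => /(_ isT).
by rewrite /= ij jk kl => /eqP.
Qed.

(** Makes a partition recoverable from its block function. *)
Lemma partition_blocks : P = [set finset.pblock P i | i : 'I_n.+1]%SET.
Proof.
apply/setP => V; apply/idP/imsetP => [VP|[i _ ->]]; last first.
  by rewrite pblock_mem // (cover_partition partP) finset.in_setT.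
have /set0Pn[i iV] : V != finset.set0.
  by apply/eqP => V0; move: VP; rewrite V0 (partition0 partP).
by exists i => //; rewrite (def_pblock (partition_trivIset partP) VP iV).
Qed.

End Partition.

Lemma partition_min_map_inj P Q :
  finset.partition P [set: 'I_n.+1] -> finset.partition Q [set: 'I_n.+1] ->
  (forall m, (m < n.+1)%N -> min_map P m = min_map Q m) -> P = Q.
Proof.
move=> partP partQ E; rewrite (partition_blocks partP) (partition_blocks partQ).
apply: eq_imset => i; apply/setP => j; rewrite -!same_blockE //.
by rewrite -!block_min_eq // -!val_eqE /= -!min_map_val !E.
Qed.

(** Reading the word with the stack recovers the minimum of every block, hence the
    partition. *)
Lemma word_inj : {in NC n.+1 &, injective word}.
Proof.
move=> P Q; rewrite !inE => /andP[partP ncP] /andP[partQ ncQ] EPQ.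
apply: partition_min_map_inj => // m mN.
have EL k : (k < n.+1)%N -> letters_of P k = letters_of Q k.
  move=> kN; move: EPQ; rewrite !word_iota => /(congr1 (nth (true, true) ^~ k)).
  by rewrite !(nth_map 0%N) ?size_iota // nth_iota.
have codQ : codes n.+1 (min_map Q) (letters_of P).
  by move=> k kN; rewrite EL //; exact: min_map_codes.
rewrite -(opener_ncmapE (min_map_ncmap partP ncP) (min_map_codes partP) mN).
exact: (opener_ncmapE (min_map_ncmap partQ ncQ) codQ mN).
Qed.

Lemma word_valid P : P \in NC n.+1 -> valid 0 (word P).
Proof.
rewrite inE => /andP[partP ncP]; rewrite word_iota; apply/valid_complete.
exact: ncmap_complete (min_map_ncmap partP ncP) (min_map_codes partP).
Qed.

(** The blocks are the fibres of [opener]. *)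
Lemma word_surj w : size w = n.+1 -> valid 0 w -> exists2 P, P \in NC n.+1 & word P = w.
Proof.
move=> szw; pose L := nth (true, true) w.
have wE : w = [seq L i | i <- iota 0 n.+1].
  by rewrite -szw; apply/esym/mkseq_nth.
rewrite wE => /valid_complete/opener_ncmap[[le_f idem nc] cod].
pose P := preim_partition (fun i : 'I_n.+1 => opener L i) [set: 'I_n.+1].
have partP : finset.partition P [set: 'I_n.+1] by exact: preim_partitionP.
have blockE (i j : 'I_n.+1) : (j \in finset.pblock P i) = (opener L i == opener L j).
  rewrite (pblock_equivalence_partition (R := fun x y : 'I_n.+1 => opener L x == opener L y))
    ?finset.in_setT //.
  by move=> x y z _ _ _; split=> // /eqP ->.
have minE m : (m < n.+1)%N -> min_map P m = opener L m.
  move=> mN; rewrite -[m]/(val (Ordinal mN)) min_map_val.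
  have oN : (opener L m < n.+1)%N by exact: leq_ltn_trans (le_f _ mN) mN.
  apply/eqP; rewrite eqn_leq; apply/andP; split.
    apply: (@block_min_le _ partP _ (Ordinal oN)).
    by rewrite blockE /= idem.
  have := block_min_in partP (Ordinal mN); rewrite blockE => /eqP /= ->.
  exact: le_f (ltn_ord _).
exists P.
  rewrite inE partP; apply/forall_inP => V VP; apply/forall_inP => W WP.
  apply/forall_inP => i iV; apply/forall_inP => j jW.
  apply/forall_inP => k kV; apply/forall_inP => l lW; apply/implyP.
  case/and3P=> ij jk kl.
  have trivP := partition_trivIset partP.
  rewrite -(def_pblock trivP VP iV) in kV *.
  rewrite -(def_pblock trivP WP jW) in lW *.
  rewrite same_blockE // blockE; rewrite !blockE in kV lW.
  by apply/eqP/(nc _ _ _ _ ij jk kl (ltn_ord l)); exact/eqP.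
rewrite word_iota; apply/eq_in_map => m; rewrite mem_iota /= => mN.
have [P1 P2] := min_map_codes partP mN; have [L1 L2] := cod m mN.
rewrite [LHS]surjective_pairing [RHS]surjective_pairing; congr (_, _); apply/idP/idP.
- by move/P1; rewrite minE // => /L1.
- by move/L1 => E; apply/P1; rewrite minE.
- move/P2 => h; apply/L2 => j jN; have jn : (j < n.+1)%N by case/andP: jN.
  by have := h j jN; rewrite !minE.
- move/L2 => h; apply/P2 => j jN; have jn : (j < n.+1)%N by case/andP: jN.
  by have := h j jN; rewrite !minE.
Qed.

Lemma big_NC_word (V : nmodType) (f : seq (bool * bool) -> V) :
  \sum_(P in NC n.+1) f (word P) = \sum_(w <- words n.+1 | valid 0 w) f w.
Proof.
rewrite -[RHS]big_filter -big_enum -(big_map word xpredT f); apply: perm_big.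
apply: uniq_perm; first by rewrite map_inj_in_uniq ?enum_uniq // => P Q;
    rewrite !mem_enum; exact: word_inj.
  by rewrite filter_uniq // uniq_words.
move=> w; rewrite mem_filter mem_words; apply/mapP/andP.
  case=> P; rewrite mem_enum => PNC ->; split; first exact: word_valid.
  by rewrite size_map -cardE card_ord.
case=> vw /eqP szw; have [P PNC <-] := word_surj szw vw.
by exists P; rewrite ?mem_enum.
Qed.

End PartitionWord.

(** * The sum of nested functionals over non-crossing partitions *)

Section NestedSums.
Variables (K : fieldType) (B : algType K).
Implicit Types F G : ser B.

Definition letter_symbol (c : bool * bool) F : symbol B :=
  if c.1 && c.2 then SSingle F else if c.1 then SOpen F
  else if c.2 then SClose B else SComma B.

Definition final (st : B * seq (frame B)) : B := if st is (x, [::]) then x else 0.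

Section EvalWord.
Variables (G0 G : ser B).

Fixpoint eval_word (st : B * seq (frame B)) (s : seq B) (w : seq (bool * bool)) : B :=
  match s, w with
  | b :: s', c :: w' =>
    eval_word (read_symbol (read_symbol st (SArg b))
                 (letter_symbol c (next_ser G0 G st.2))) s' w'
  | _, _ => final st
  end.

Lemma eval_words st s :
  \sum_(w <- words (size s) | valid (size st.2) w) eval_word st s w =
  parse_sum G0 G st s.
Proof.
elim: s st => [|b s IHs] st.
  by rewrite big_mkcond big_seq1 /=; case: st => x [].
rewrite parse_sum_cons -!IHs big_mkcond.
rewrite (big_words_cons _ (fun w => if valid (size st.2) w then
  eval_word st (b :: s) w else 0)) -!big_mkcond /=.
case: st => x [|[[y F] a] st] /=; last by rewrite !addn0 !addn1 !subn1 subn0.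
by congr (_ + _); rewrite !big_pred0_eq addr0.
Qed.

Definition eval_first F (s : seq B) (w : seq (bool * bool)) : B :=
  if w is c :: w' then eval_word (read_symbol (1, [::]) (letter_symbol c F)) s w'
  else 0.

Lemma eval_first_words F s :
  \sum_(w <- words (size s).+1 | valid 0 w) eval_first F s w =
  (ws_comp (ser_word F) (ws_arg (ser_word G)) * ws_tail G0 G) s.
Proof.
rewrite -parse_sum_first -!eval_words [LHS]big_mkcond.
rewrite (big_words_cons _ (fun w => if valid 0 w then eval_first F s w else 0)).
rewrite -!big_mkcond /= !big1_eq !addr0 mul1r ser_word_nil.
by [].
Qed.

Variable n : nat.
Implicit Types P : {set {set 'I_n.+1}}.

(** In a non-crossing partition, the block with minimum m is nested inside another
    one exactly when m is covered. *)
Definition covered P (m : 'I_n.+1) : bool :=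
  [exists i : 'I_n.+1, exists j : 'I_n.+1,
     (i < m <= j)%N && (finset.pblock P i == finset.pblock P j)].

Lemma nested_symbolE (S : {set 'I_n.+1} -> ser B) P m :
  finset.partition P [set: 'I_n.+1] ->
  nested_symbol S P m = letter_symbol (letter P m) (S (finset.pblock P m)).
Proof.
move=> partP; rewrite /nested_symbol /letter_symbol /letter /=.
rewrite -/(is_min P m) -/(is_max P m).
have mV := mem_block partP m.
case: ifP => [/cards1P[x Vx]|card1].
  have mx : m = x by apply/finset.set1P; rewrite -Vx.
  have one j : j \in finset.pblock P m -> j = m.
    by rewrite Vx mx => /finset.set1P.
  have -> : is_min P m by apply/forall_inP => j /one ->.
  by have -> : is_max P m by apply/forall_inP => j /one ->.
case mn : (is_min P m) => //=; case mx : (is_max P m) => //.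
case/negP: card1; apply/cards1P; exists m; apply/setP => j; rewrite finset.in_set1.
apply/idP/eqP => [jV|-> //]; apply/val_inj/eqP; rewrite eqn_leq.
by rewrite (forall_inP mx _ jV) (forall_inP mn _ jV).
Qed.

Lemma coveredP P (m : 'I_n.+1) : P \in NC n.+1 ->
  covered P m <-> stack_before (letters_of P) m <> [::].
Proof.
rewrite inE => /andP[partP ncP].
have H := ncmap_stack_nilP (min_map_ncmap partP ncP) (min_map_codes partP) (ltn_ord m).
split=> [/existsP[i /existsP[j /andP[/andP[im mj] /eqP E]]]|/H].
  apply/H; exists i, j; split=> //; first by rewrite mj ltn_ord.
  exact/min_map_eq.
case=> i [j [im /andP[mj jN] E]].
have iN := ltn_trans im (ltn_ord m).
apply/existsP; exists (Ordinal iN); apply/existsP; exists (Ordinal jN).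
by rewrite /= im mj; apply/eqP/(min_map_eq partP).
Qed.

(** Along the string of P, the stack of parentheses has the same height as the
    stack of open blocks, so it is empty at the minimum of a block exactly when
    this block is outer. *)
Lemma nested_eval F (S : {set 'I_n.+1} -> ser B) P (b : n.-tuple B) :
  P \in NC n.+1 ->
  (forall m, is_min P m -> S (finset.pblock P m) =
     if m == ord0 then F else if covered P m then G else G0) ->
  nested S P b = eval_first F b (word P).
Proof.
move=> PNC HS; have partP : finset.partition P [set: 'I_n.+1].
  by move: PNC; rewrite inE => /andP[].
have [nz _] : complete (letters_of P) n.+1.
  by apply/valid_complete; rewrite -word_iota word_valid.
pose L := letters_of P.
have LE (m : 'I_n.+1) : letter P m = L m by rewrite /L /letters_of inord_val.
have symE (m : 'I_n.+1) H : (is_min P m -> S (finset.pblock P m) = H) ->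
    nested_symbol S P m = letter_symbol (letter P m) H.
  move=> HH; rewrite nested_symbolE // /letter_symbol /=.
  by case: (is_min P m) HH => //= ->.
have step (st : B * seq (frame B)) (m : 'I_n.+1) H :
    size st.2 = size (stack_before L m) ->
    size (read_symbol st (letter_symbol (letter P m) H)).2 =
    size (stack_before L m.+1).
  move=> szst; rewrite size_stack_beforeS; last exact: nz.
  have : ((L m).1 || (0 < size st.2))%N.
    rewrite szst; have := nz m (ltn_ord m); rewrite /stack_at -/L.
    by case: (L m).1 => //; case: stack_before.
  rewrite -szst LE /letter_symbol; case: st {szst} => x [|[[y F'] a] st];
    by case: (L m) => -[] [] //= _; rewrite ?addn1 ?addn0 ?subn1 ?subn0.
pose f (i : 'I_n) := [:: SArg (tnth b i); nested_symbol S P (lift ord0 i)].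
have main r k st : map val r = iota k (size r) ->
    size st.2 = size (stack_before L k.+1) ->
    final (foldl (@read_symbol _ _) st (flatten [seq f i | i <- r])) =
    eval_word st [seq tnth b i | i <- r] [seq letter P (lift ord0 i) | i <- r].
  elim: r k st => [|i r IHr] k st //= [ik rk] szst.
  have szst1 : size (read_symbol st (SArg (tnth b i))).2 = size st.2 by case: st {szst}.
  have iL : lift ord0 i = k.+1 :> nat by rewrite lift0 -ik.
  rewrite (symE _ (next_ser G0 G st.2)).
    by apply: (IHr k.+1) => //; rewrite step ?szst1 ?szst iL.
  move=> /HS ->; rewrite eq_sym (negbTE (neq_lift _ _)).
  have st0 : (st.2 == [::]) = (stack_before L k.+1 == [::]).
    by rewrite -!size_eq0 szst.
  have cov : covered P (lift ord0 i) = (stack_before L k.+1 != [::]).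
    by apply/idP/(negPP eqP); rewrite -iL => /(coveredP (lift ord0 i) PNC).
  by rewrite cov -st0 /next_ser; case: st.2.
rewrite /nested /eval_string -/(final _) /nested_string /= /word enum_ordSl /=.
rewrite (symE ord0 F); last by move=> /HS ->; rewrite eqxx.
rewrite -[tval b]map_tnth_enum -map_comp; apply: (main _ 0%N).
  by rewrite val_enum_ord size_enum_ord.
exact: step.
Qed.

Lemma sum_nested F (S : {set {set 'I_n.+1}} -> {set 'I_n.+1} -> ser B) (b : n.-tuple B) :
  (forall P m, P \in NC n.+1 -> is_min P m -> S P (finset.pblock P m) =
     if m == ord0 then F else if covered P m then G else G0) ->
  \sum_(P in NC n.+1) nested (S P) P b =
  (ws_comp (ser_word F) (ws_arg (ser_word G)) * ws_tail G0 G) b.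
Proof.
move=> HS; rewrite -eval_first_words size_tuple -big_NC_word.
by apply: eq_bigr => P PNC; apply: nested_eval => // m; exact: HS.
Qed.

End EvalWord.

End NestedSums.

(** * Interval partitions and the map RBhat *)

Section ZeroTerm.
Variables (K : fieldType) (B : algType K).

Lemma final_zero w (st : seq (frame B)) :
  final (foldl (@read_symbol _ _) (0, st) w) = 0.
Proof.
have := @hot_foldl _ _ w (fun x => (x, st)) (hot_cur (g := id) st (fun _ _ _ => erefl)).
exact: linear_fun0.
Qed.

(** An open parenthesis of the zero series either is never closed or produces the
    factor 0. *)
Lemma final_zero_frame w x st1 y (s : seq B) st2 :
  final (foldl (@read_symbol _ _) (x, st1 ++ (y, zero_ser B, s) :: st2) w) = 0.
Proof.
elim: w x st1 s => [|c w IHw] x st1 s /=; first by case: st1.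
case: c => [F|||F|b] /=; try exact: IHw.
- exact: (IHw 1 ((x, F, [::]) :: st1)).
- by case: st1 => [|[[y' F] s'] st1] /=;
    [exact: (IHw 1 [::]) | exact: (IHw 1 ((y', F, rcons s' x) :: st1))].
- case: st1 => [|[[y' F] s'] st1] /=; last exact: IHw.
  by rewrite mulr0 final_zero.
Qed.

(** Assigning the zero series to a block removes the partition from a sum; in this
    way sums over special classes of partitions become sums over all of NC. *)
Lemma nested_zero n (S : {set 'I_n.+1} -> ser B) P m (b : n.-tuple B) :
  finset.partition P [set: 'I_n.+1] -> is_min P m ->
  S (finset.pblock P m) = zero_ser B -> nested S P b = 0.
Proof.
move=> partP mn S0; rewrite /nested.
have [w1 [w2 ->]] : exists w1 w2,
    nested_string S P b = w1 ++ nested_symbol S P m :: w2.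
  rewrite /nested_string; case: (unliftP ord0 m) => [i ->|->]; last first.
    by exists [::]; eexists.
  have /splitPr[s1 s2] : i \in enum 'I_n by rewrite mem_enum.
  rewrite map_cat flatten_cat /=; set u := flatten _; set v := flatten _.
  by exists (nested_symbol S P ord0 :: u ++ [:: SArg (tnth b i)]), v; rewrite /= -catA.
rewrite /eval_string -/(final _) (nested_symbolE S m partP) S0 /letter_symbol /= mn.
rewrite foldl_cat /=; case: (foldl _ _ w1) => x st.
case: (is_max P m) => /=; first by rewrite mulr0 final_zero.
exact: (final_zero_frame w2 1 [::]).
Qed.

End ZeroTerm.

Section Sums.
Variables (K : fieldType) (B : algType K).
Implicit Types F G : ser B.

Lemma ser_word_zero : ser_word (zero_ser B) = 0.
Proof. by []. Qed.

Lemma ws_tail_zero G : ws_tail (zero_ser B) G = 1.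
Proof. by rewrite ws_tailE ser_word_zero ws_comp0l mulr0 mul0r addr0. Qed.

Lemma sum_NC F n (b : n.-tuple B) :
  \sum_(P in NC n.+1) nested (fun=> F) P b =
  (ws_comp (ser_word F) (ws_arg (ser_word F)) * ws_tail F F) b.
Proof.
apply: (@sum_nested _ _ F F n F (fun=> (fun=> F))) => P m _ _.
by case: ifP => // _; case: ifP.
Qed.

Lemma eq_nested n (S S' : {set 'I_n.+1} -> ser B) P (b : n.-tuple B) :
  (forall m, S (finset.pblock P m) = S' (finset.pblock P m)) ->
  nested S P b = nested S' P b.
Proof.
move=> E; have symE m : nested_symbol S P m = nested_symbol S' P m.
  by rewrite /nested_symbol E.
rewrite /nested /nested_string symE; congr (eval_string (_ :: flatten _)).
by apply: eq_map => i; rewrite symE.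
Qed.

Section Covered.
Variable n : nat.
Implicit Types P : {set {set 'I_n.+1}}.

(** Membership of the minimum is tested through all points of V, so that no choice
    of a minimum of an arbitrary set V is required. *)
Definition covered_block P (V : {set 'I_n.+1}) : bool :=
  [exists m in V, is_min P m && covered P m].

Lemma covered_block_min P m : P \in NC n.+1 -> is_min P m ->
  covered_block P (finset.pblock P m) = covered P m.
Proof.
rewrite inE => /andP[partP _] mn; apply/existsP/idP => [[k]|cov].
  case/and3P=> km kmin; suff -> : k = m by [].
  apply/val_inj/eqP; rewrite eqn_leq (forall_inP mn _ km) andbT.
  have mk : m \in finset.pblock P k.
    by move: km; rewrite -!same_blockE // eq_sym.
  exact: (forall_inP kmin _ mk).
by exists m; rewrite mem_block // mn.
Qed.

Lemma covered0 P : covered P ord0 = false.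
Proof. by apply/existsP => -[i /existsP[j]]; rewrite ltn0. Qed.

Lemma Intp_uncovered P m : P \in Intp n.+1 -> is_min P m -> ~~ covered P m.
Proof.
rewrite inE => /andP[partP /forall_inP int] mn.
apply/existsP => -[i /existsP[j /andP[/andP[im mj] /eqP ij]]].
have PV x : finset.pblock P x \in P.
  by rewrite pblock_mem // (cover_partition partP) finset.in_setT.
have /forall_inP/(_ _ (mem_block partP i))/forall_inP/(_ j) := int _ (PV i).
rewrite -same_blockE // ij eqxx => /(_ isT)/forallP/(_ m).
rewrite (ltnW im) mj -same_blockE // eq_sym -ij same_blockE // => im'.
by have := forall_inP mn _ im'; rewrite leqNgt im.
Qed.

Lemma block_of_min P x : finset.partition P [set: 'I_n.+1] ->
  finset.pblock P (block_min P x) = finset.pblock P x.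
Proof. by move=> partP; apply/eqP; rewrite eq_sym same_blockE // block_min_in. Qed.

Lemma block_min_is_min P x : finset.partition P [set: 'I_n.+1] ->
  is_min P (block_min P x).
Proof.
by move=> partP; apply/forall_inP => y; rewrite block_of_min //; exact: block_min_le.
Qed.

(** If the block of a point k between two points of a block V differed from V, then
    the larger of the two minima would be covered by the other block. *)
Lemma NC_uncovered P : P \in NC n.+1 ->
  (forall m, is_min P m -> ~~ covered P m) -> P \in Intp n.+1.
Proof.
rewrite !inE => /andP[partP _] unc; rewrite partP /=.
apply/forall_inP => V VP; apply/forall_inP => i iV; apply/forall_inP => j jV.
apply/forallP => k; apply/implyP => /andP[ik kj].
have trivP := partition_trivIset partP.
rewrite -(def_pblock trivP VP iV) in jV *.
have minE x : ~~ covered P (block_min P x) by apply: unc; exact: block_min_is_min.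
have le_min x : (block_min P x <= x)%N by rewrite block_min_le ?mem_block.
rewrite -same_blockE // -block_min_eq // -val_eqE /=.
case: ltngtP => // lt; [case/negP: (minE k)|case/negP: (minE i)].
  apply/existsP; exists (block_min P i); apply/existsP; exists j.
  by rewrite lt (leq_trans (le_min k)) //= block_of_min // same_blockE.
apply/existsP; exists (block_min P k); apply/existsP; exists k.
by rewrite lt (leq_trans (le_min i)) //= block_of_min.
Qed.

Lemma Intp_sub_NC P : P \in Intp n.+1 -> P \in NC n.+1.
Proof.
rewrite !inE => /andP[partP /forall_inP int]; rewrite partP /=.
apply/forall_inP => V VP; apply/forall_inP => W WP.
apply/forall_inP => i iV; apply/forall_inP => j jW.
apply/forall_inP => k kV; apply/forall_inP => l lW; apply/implyP.
case/and3P=> ij jk _.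
have /forall_inP/(_ _ iV)/forall_inP/(_ _ kV)/forallP/(_ j) := int _ VP.
rewrite (ltnW ij) (ltnW jk) => jV; have trivP := partition_trivIset partP.
by rewrite -(def_pblock trivP VP jV) (def_pblock trivP WP jW).
Qed.

End Covered.

(** Interval partitions are the non-crossing partitions without nested blocks, so
    nested blocks receive the zero series; then Phi_0 = X and composition with X
    is trivial. *)
Lemma sum_Intp F n (b : n.-tuple B) :
  \sum_(P in Intp n.+1) nested (fun=> F) P b =
  (ser_word F * ws_tail F (zero_ser B)) b.
Proof.
pose S (P : {set {set 'I_n.+1}}) V := if covered_block P V then zero_ser B else F.
have -> : ser_word F = ws_comp (ser_word F) (ws_arg (ser_word (zero_ser B))).
  by rewrite ser_word_zero ws_arg0 ws_comp_id //; exact: ser_word_multilinear.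
rewrite -(sum_nested (S := S)) => [|P m PNC mn]; last first.
  rewrite /S covered_block_min //; case: eqP => [->|_ //].
  by rewrite covered0.
rewrite [RHS](bigID (fun P => P \in Intp n.+1)) /= [X in _ + X]big1 ?addr0.
  apply: eq_big => [P|P PInt].
    by apply/idP/andP => [PInt|[]//]; split=> //; exact: Intp_sub_NC.
  congr (nested _ P b); apply/funext => V; rewrite /S /covered_block.
  case: ifP => // /existsP[m /and3P[_ mn]].
  by rewrite (negbTE (Intp_uncovered PInt mn)).
move=> P /andP[PNC nInt].
have [m /andP[mn cov]] : exists m, is_min P m && covered P m.
  apply/existsP; apply: contraNT nInt; rewrite negb_exists => /forallP h.
  by apply: NC_uncovered => // m mn; have := h m; rewrite mn.
apply: (@nested_zero _ _ _ _ _ m) => //; first by move: PNC; rewrite inE => /andP[].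
by rewrite /S covered_block_min // cov.
Qed.

(** Outer blocks other than that of the first point receive the zero series.  Such
    a block exists, namely the block of the last point, unless the first and
    last points share a block, and in that case all other blocks are nested. *)
Lemma RBhatE (alpha : {linear B -> B}) F :
  ser_word (RBhat alpha F) =
  ws_comp (ser_word F) (ws_arg (ser_word (comp_ser alpha F))).
Proof.
apply/funext => s; set G := comp_ser alpha F.
pose S (P : {set {set 'I_(size s).+1}}) V := if V == finset.pblock P ord0 then F
  else if covered_block P V then G else zero_ser B.
have E := @sum_nested _ _ (zero_ser B) G _ F S (in_tuple s).
rewrite ws_tail_zero mulr1 /= in E; rewrite -E => [{E}|P m PNC mn]; last first.
  have partP : finset.partition P [set: 'I_(size s).+1].
    by move: PNC; rewrite inE => /andP[].
  rewrite /S covered_block_min // (_ : (_ == _) = (m == ord0)) //.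
  apply/idP/eqP => [|-> //]; rewrite same_blockE // => /(forall_inP mn).
  by rewrite leqn0 => /eqP m0; exact: val_inj.
rewrite [RHS](bigID (fun P => finset.pblock P ord0 == finset.pblock P ord_max)).
rewrite /= [X in _ + X]big1 ?addr0 => [|P /andP[PNC neq]].
  apply: eq_bigr => P /andP[PNC eq0]; have partP : finset.partition P [set: 'I_(size s).+1].
    by move: PNC; rewrite inE => /andP[].
  apply: eq_nested => m; rewrite /coloured /S /= -!/(finset.pblock P _).
  case: eqP => // neq; rewrite (_ : covered_block P _); first by [].
  rewrite -(block_of_min m partP); rewrite covered_block_min //; last first.
    exact: block_min_is_min.
  apply/existsP; exists ord0; apply/existsP; exists ord_max.
  rewrite eq0 andbT leq_ord andbT lt0n; apply: contra_not_neq neq => m0.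
  by rewrite -(block_of_min m partP); congr (finset.pblock P _); exact: val_inj.
have partP : finset.partition P [set: 'I_(size s).+1].
  by move: PNC; rewrite inE => /andP[].
have ncP : noncrossing P by move: PNC; rewrite inE => /andP[].
pose m := block_min P ord_max.
apply: (@nested_zero _ _ _ _ _ m) => //; first exact: block_min_is_min.
rewrite /S covered_block_min ?block_min_is_min // block_of_min // eq_sym (negbTE neq).
case: ifP => // /existsP[i /existsP[j /andP[/andP[im mj] /eqP ij]]].
have nW x : finset.pblock P x = finset.pblock P i -> x <> m /\ x <> ord_max.
  move=> xi; have : finset.pblock P x <> finset.pblock P m.
    move=> E; have : (m <= i)%N; last by rewrite leqNgt im.
    by apply: block_min_le => //; rewrite -same_blockE // -block_of_min // -/m -E xi.
  by rewrite block_of_min // => h; split=> E; apply: h; rewrite E ?block_of_min.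
have [jm jx] := nW j (esym ij).
have ltmj : (m < j)%N.
  by rewrite ltn_neqAle mj andbT; apply/eqP => /val_inj /esym.
have ltj : (j < (ord_max : 'I_(size s).+1))%N.
  by rewrite ltn_neqAle leq_ord andbT; apply/eqP => /val_inj.
have [_ _ nc] := min_map_ncmap partP ncP.
have /min_map_eq-/(_ partP) E := nc i m j ord_max im ltmj ltj (ltn_ord _)
   (proj2 (min_map_eq partP _ _) ij)
   (proj2 (min_map_eq partP _ _) (block_of_min _ partP)).
by case: (nW m (esym E)).
Qed.

End Sums.

(** * Boolean and free transforms of series *)

Section Transforms.
Variables (K : fieldType) (B : algType K).
Implicit Types F G M : ser B.

Lemma ser_word_inj : injective (@ser_word K B).
Proof.
move=> [f fml] [g gml] E.
have Efg : f = g.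
  apply/functional_extensionality_dep => n; apply/funext => b.
  have := congr1 (fun h : wordseries B => h b) E.
  by rewrite /ser_word !ser_in_tuple.
by case: g / Efg gml {E} => gml; congr Ser; exact: Prop_irrelevance.
Qed.

Definition sum_over (C : forall n, pred {set {set 'I_n.+1}}) F n (b : n.-tuple B) : B :=
  \sum_(P | C n P) nested (fun=> F) P b.

Lemma sum_over_multilinear C F n : multilinear (@sum_over C F n).
Proof. by apply: multilinear_sum => P; exact: nested_multilinear. Qed.

Definition free_series F : ser B :=
  Ser (sum_over_multilinear (fun n => [pred P in NC n.+1]) F).

Definition boolean_series F : ser B :=
  Ser (sum_over_multilinear (fun n => [pred P in Intp n.+1]) F).

Lemma boolean_seriesE F :
  ser_word (boolean_series F) = ser_word F * ws_tail F (zero_ser B).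
Proof. by apply/funext => s; exact: (sum_Intp F (in_tuple s)). Qed.

Lemma boolean_tailE F : ws_tail F (zero_ser B) =
  1 + wsX * ser_word F * ws_tail F (zero_ser B).
Proof.
rewrite {1}ws_tailE ser_word_zero ws_arg0 ws_comp_id //; exact: ser_word_multilinear.
Qed.

Lemma ser_word_comp (alpha : {linear B -> B}) F s :
  ser_word (comp_ser alpha F) s = alpha (ser_word F s).
Proof. by []. Qed.

Lemma comp_ser_idfun F : comp_ser idfun F = F.
Proof. exact: ser_word_inj. Qed.

(** Grouping the blocks of a non-crossing partition under its outer blocks. *)
Lemma free_series_boolean F : free_series F = boolean_series (RBhat idfun F).
Proof.
apply: ser_word_inj; rewrite boolean_seriesE RBhatE comp_ser_idfun.
have -> : ws_tail (RBhat idfun F) (zero_ser B) = ws_tail F F.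
  apply: (ws_linear_unique (boolean_tailE _)).
  by rewrite RBhatE comp_ser_idfun; exact: ws_tailE.
by apply/funext => s; exact: (sum_NC F (in_tuple s)).
Qed.

Definition opp_ser F : ser B := comp_ser (\- idfun) F.

Lemma ser_word_opp F : ser_word (opp_ser F) = - ser_word F.
Proof. by []. Qed.

(** The boolean formula is M = F (1 + X M), hence F = M (1 + X M)^-1, and the
    geometric series (1 + X M)^-1 is the series Y attached to - M.  Up to signs
    the inverse is therefore again a sum over interval partitions, which makes its
    multilinearity automatic. *)
Definition boolean_inverse M : ser B := opp_ser (boolean_series (opp_ser M)).

Lemma boolean_inverseE M :
  ser_word (boolean_inverse M) = ser_word M * ws_tail (opp_ser M) (zero_ser B).
Proof.
by rewrite ser_word_opp boolean_seriesE ser_word_opp mulNr opprK.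
Qed.

Lemma boolean_seriesK : cancel boolean_series boolean_inverse.
Proof.
move=> F; apply: ser_word_inj; rewrite boolean_inverseE.
set M := boolean_series F; set Y := ws_tail _ _.
have ET : ws_tail F (zero_ser B) = 1 + wsX * ser_word M.
  by rewrite {1}boolean_tailE /M boolean_seriesE mulrA.
have EY : (1 + wsX * ser_word M) * Y = 1.
  rewrite mulrDl mul1r {1}/Y boolean_tailE -/Y ser_word_opp mulrN mulNr.
  by rewrite addrNK.
by rewrite {1}/M boolean_seriesE ET -mulrA EY mulr1.
Qed.

Lemma boolean_inverseK : cancel boolean_inverse boolean_series.
Proof.
move=> M; apply: ser_word_inj; rewrite boolean_seriesE.
set Y := ws_tail (opp_ser M) (zero_ser B).
have EY : Y * (1 + wsX * ser_word M) = 1.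
  apply: (@ws_linear_unique _ _ (1 + wsX * ser_word M) _ _ (- ser_word M)).
    by rewrite {1}/Y boolean_tailE -/Y mulrDl mul1r mulrA ser_word_opp.
  by rewrite mulr1 mulrN addrK.
have EB : ser_word (boolean_inverse M) * (1 + wsX * ser_word M) = ser_word M.
  by rewrite boolean_inverseE -mulrA EY mulr1.
rewrite -[RHS]EB; congr (_ * _).
apply: (ws_linear_unique (boolean_tailE _)).
by rewrite -[in RHS]mulrA EB.
Qed.

(** RBhat_beta(F) = F o Phi_{beta o F}, so both sides are compositions of F with
    series of the form Phi, which [ws_arg_comp] identifies. *)
Lemma RBhat_comp (alpha beta : {linear B -> B}) F :
  RBhat alpha (RBhat beta F) = RBhat (alpha \+ beta) F.
Proof.
apply: ser_word_inj; rewrite !RBhatE.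
have lin_comp f g s : alpha (ws_comp (ser_word f) g s) =
    ws_comp (ser_word (comp_ser alpha f)) g s by rewrite /ws_comp linear_sum.
have -> : ser_word (comp_ser alpha (RBhat beta F)) =
    ws_comp (ser_word (comp_ser alpha F)) (ws_arg (ser_word (comp_ser beta F))).
  by apply/funext => s; rewrite ser_word_comp RBhatE lin_comp.
rewrite ws_compA; last exact: ser_word_multilinear.
by rewrite ws_arg_comp //; exact: ser_word_multilinear.
Qed.

Lemma RBhat_zero F : RBhat \0 F = F.
Proof.
apply: ser_word_inj; rewrite RBhatE (_ : ser_word (comp_ser _ F) = 0) //.
by rewrite ws_arg0 ws_comp_id //; exact: ser_word_multilinear.
Qed.

Lemma eq_RBhat (alpha beta : {linear B -> B}) F :
  alpha =1 beta -> RBhat alpha F = RBhat beta F.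
Proof.
move=> E; apply: ser_word_inj; rewrite !RBhatE; congr (ws_comp _ (ws_arg _)).
by apply/funext => s; rewrite !ser_word_comp.
Qed.

Lemma RBhatK (alpha : {linear B -> B}) : cancel (RBhat alpha) (RBhat (\- alpha)).
Proof.
move=> F; rewrite RBhat_comp (@eq_RBhat _ \0) ?RBhat_zero // => x /=.
by rewrite addNr.
Qed.

Lemma RBhatKN (alpha : {linear B -> B}) : cancel (RBhat (\- alpha)) (RBhat alpha).
Proof.
move=> F; rewrite RBhat_comp (@eq_RBhat _ \0) ?RBhat_zero // => x /=.
by rewrite addrN.
Qed.

Lemma free_series_bij : bijective free_series.
Proof.
exists (RBhat (\- idfun) \o boolean_inverse) => F /=.
  by rewrite free_series_boolean boolean_seriesK RBhatK.
by rewrite free_series_boolean RBhatKN boolean_inverseK.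
Qed.

End Transforms.

(** * Distributions with given moments *)

Section Moments.
Local Open Scope quotient_scope.
Variables (K : fieldType) (B : algType K).

(** A functional on monomials b_0 X b_1 ... X b_n, as a function of the list
    b_{n-1}, ..., b_0 of completed coefficients and of the last coefficient b_n.
    Polynomials act on these functionals by multiplication on the right of the
    monomial, which defines linear functionals on the presented algebra without
    normal forms. *)
Definition continuation : Type := seq B -> B -> B.
Implicit Types k : continuation.

Fixpoint act (p : ncexpr B) k : continuation :=
  match p with
  | NCX => fun s b => k (b :: s) 1
  | NCconst a => fun s b => k s (b * a)
  | NCadd p q => fun s b => act p k s b + act q k s b
  | NCmul p q => act p (act q k)
  end.

Definition cont_multilinear k : Prop :=
  (forall s, linear (k s)) /\
  (forall s1 s2 b, linear (fun x => k (s1 ++ x :: s2) b)).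

Lemma act_multilinear p k : cont_multilinear k -> cont_multilinear (act p k).
Proof.
elim: p k => [|a|p IHp q IHq|p IHp q IHq] k kml /=; last exact/IHp/IHq.
- case: kml => _ k2; split=> [s|s1 s2 b]; first exact: (k2 [::] s 1).
  exact: (k2 (b :: s1) s2 1).
- case: kml => k1 k2; split=> [s|s1 s2 b]; last exact: k2.
  by move=> c x y; rewrite mulrDl -scalerAl k1.
- have [p1 p2] := IHp _ kml; have [q1 q2] := IHq _ kml.
  split=> [s|s1 s2 b] c x y; first by rewrite p1 q1 scalerDr addrACA.
  by rewrite (p2 s1 s2 b) (q2 s1 s2 b) scalerDr addrACA.
Qed.

Lemma act_linear p c k1 k2 :
  act p (fun s b => c *: k1 s b + k2 s b) =
  fun s b => c *: act p k1 s b + act p k2 s b.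
Proof.
elim: p k1 k2 => [|a|p IHp q IHq|p IHp q IHq] k1 k2 //=; last by rewrite IHq IHp.
by apply/funext => s; apply/funext => b; rewrite IHp IHq scalerDr addrACA.
Qed.

(** The relations of the presentation hold for the action on multilinear
    functionals. *)
Lemma act_eq p q k : ncexpr_eq p q -> cont_multilinear k -> act p k = act q k.
Proof.
move=> E; elim: E k => {p q} [p|p q _ IH|p q r _ IH1 _ IH2|p p' q q' _ IH1 _ IH2
  |p p' q q' _ IH1 _ IH2|p q r|p q|p|p q r|p|p|p|p q r|p q r|a b|a b|c p] k kml //=.
- by rewrite IH.
- by rewrite IH1 // IH2.
- by rewrite IH1 // IH2.
- by rewrite IH2 // IH1 //; exact: act_multilinear.
- by apply/funext => s; apply/funext => b; rewrite addrA.
- by apply/funext => s; apply/funext => b; rewrite addrC.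
- apply/funext => s; apply/funext => b.
  by rewrite mulr0 (linear_fun0 (kml.1 s)) add0r.
- by apply/funext => s; apply/funext => b; rewrite mulr1.
- by congr (act p _); apply/funext => s; apply/funext => b; rewrite mulr1.
- apply/funext => s; apply/funext => b; rewrite !mulr0 (linear_fun0 (kml.1 s)).
  exact: linear_fun0 ((act_multilinear p kml).1 s).
- have := act_linear p 1 (act q k) (act r k).
  rewrite (_ : (fun s b => 1 *: act q k s b + act r k s b) =
    fun s b => act q k s b + act r k s b).
    by move=> ->; apply/funext => s; apply/funext => b; rewrite scale1r.
  by apply/funext => s; apply/funext => b; rewrite scale1r.
- apply/funext => s; apply/funext => x; rewrite mulrDr.
  by have := kml.1 s 1 (x * a) (x * b); rewrite !scale1r.
- by apply/funext => s; apply/funext => x; rewrite mulrA.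
(* The summand 0 brings the scaled functional to the form of [act_linear]. *)
have lin0 k' : cont_multilinear k' -> (fun s b => k' s (b * c%:A)) =
    fun s b => c *: k' s b + 0.
  move=> k'ml; apply/funext => s; apply/funext => b.
  have := k'ml.1 s c b 0; rewrite (linear_fun0 (k'ml.1 s)) addr0 mulr_algr.
  by rewrite addr0.
rewrite (lin0 _ kml) (lin0 _ (act_multilinear p kml)).
rewrite (act_linear p c k (fun _ _ => 0)); apply/funext => s; apply/funext => b.
congr (_ + _); have := act_linear p (- 1) (fun _ _ => 0) (fun _ _ => 0).
under eq_fun do under eq_fun do rewrite scaler0 addr0.
by move=> /(congr1 (fun f => f s b)) ->; rewrite scaleN1r addNr.
Qed.

Variable M : ser B.

(** The functional b_0 X b_1 ... X b_n |-> b_0 M(b_1, ..., b_{n-1}) b_n, and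
    b_0 |-> b_0 for n = 0. *)
Definition moment_cont : continuation :=
  fun s b => if rev s is b0 :: t then b0 * ser_word M t * b else b.

Lemma moment_cont_multilinear : cont_multilinear moment_cont.
Proof.
rewrite /moment_cont; split=> [s|s1 s2 b] c x y.
  by case: (rev s) => // b0 t; rewrite mulrDr scalerAr.
rewrite !rev_cat !rev_cons -!cats1 -!catA /=.
case: (rev s2) => [|b0 t] /=; first by rewrite !mulrDl !scalerAl.
by rewrite ser_word_multilinear !mulrDr !mulrDl -!scalerAr -!scalerAl.
Qed.

Lemma act_mulr a p k : (forall s b, k s (b * a) = k s b * a) ->
  forall s b, act p (fun s b => k s (b * a)) s b = act p k s b * a.
Proof.
move=> ka.
have gen q k1 s b : act q (fun s b => k1 s b * a) s b = act q k1 s b * a.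
  elim: q k1 s b => [|c|q IHq r IHr|q IHq r IHr] k1 s b //=.
    by rewrite IHq IHr mulrDl.
  rewrite -IHq; congr (act q _ s b).
  by apply/funext => s'; apply/funext => b'; exact: IHr.
move=> s b; rewrite -gen; congr (act p _ s b).
by apply/funext => s'; apply/funext => b'; exact: ka.
Qed.

(** Linearity over B acting on the coefficient b_0, which is the last one of the
    reversed list, or the current one if the list is empty. *)
Definition left_module k : Prop :=
  (forall a b, k [::] (a * b) = a * k [::] b) /\
  (forall s a b c, k (rcons s (a * b)) c = a * k (rcons s b) c).

Lemma act_left_module p k : left_module k -> left_module (act p k).
Proof.
elim: p k => [|a|p IHp q IHq|p IHp q IHq] k [k1 k2] /=; last exact/IHp/IHq.
- split=> [a b|s a b c]; first exact: (k2 [::]).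
  exact: (k2 (c :: s)).
- by split=> [b c|s b c d]; [rewrite -mulrA k1 | rewrite k2].
- have [p1 p2] := IHp _ (conj k1 k2); have [q1 q2] := IHq _ (conj k1 k2).
  by split=> [b c|s b c d]; rewrite ?p1 ?q1 ?p2 ?q2 mulrDr.
Qed.

Definition moment_expr (p : ncexpr B) : B := act p moment_cont [::] 1.

Lemma moment_expr_eq p q : ncexpr_eq p q -> moment_expr p = moment_expr q.
Proof. by move=> E; rewrite /moment_expr (act_eq E moment_cont_multilinear). Qed.

Definition moment_fun (x : ncpoly B) : B := moment_expr (repr x).

Lemma moment_fun_pi p : moment_fun (\pi_(ncpoly B) p) = moment_expr p.
Proof. exact: moment_expr_eq (nc_repr_pi p). Qed.

Lemma moment_fun_ncC_mul b x :
  moment_fun (ncC b * x) = act (repr x) moment_cont [::] b.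
Proof.
elim/ncpoly_ind: x => p; rewrite -[ncC b * _]/(ncpoly_mul _ _) -pi_ncmul moment_fun_pi.
rewrite /moment_expr /= mul1r.
by rewrite (act_eq (nc_repr_pi p) moment_cont_multilinear).
Qed.

Lemma moment_fun_linear : linear moment_fun.
Proof.
move=> c x y.
have D u v : moment_fun (u + v) = moment_fun u + moment_fun v.
  exact: moment_fun_pi.
rewrite D; congr (_ + _); rewrite -[c *: x]/(ncC c%:A * x) moment_fun_ncC_mul.
have ml := act_multilinear (repr x) moment_cont_multilinear.
have := ml.1 [::] c 1 0; rewrite !addr0 => ->.
by rewrite (linear_fun0 (ml.1 _)) addr0.
Qed.

HB.instance Definition _ :=
  GRing.isLinear.Build K (ncpoly B) B *:%R moment_fun moment_fun_linear.

Lemma moment_fun_bimod b b' p :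
  moment_fun (ncC b * p * ncC b') = b * moment_fun p * b'.
Proof.
rewrite -mulrA moment_fun_ncC_mul.
elim/ncpoly_ind: p => p; rewrite moment_fun_pi.
rewrite -[_ * ncC b']/(ncpoly_mul _ _) -pi_ncmul.
rewrite (act_eq (nc_repr_pi _) moment_cont_multilinear) /=.
rewrite act_mulr; last first.
  by move=> s c; rewrite /moment_cont; case: rev => // b0 t; rewrite mulrA.
have lm : left_module moment_cont.
  by split=> [a c|s a c d]; rewrite /moment_cont ?rev_rcons ?mulrA.
by rewrite -[X in act _ _ _ X]mulr1 (act_left_module p lm).1.
Qed.

Lemma moment_fun_ncC b : moment_fun (ncC b) = b.
Proof. by rewrite moment_fun_pi /moment_expr /= /moment_cont /= mul1r. Qed.

Definition distr_of_moments : distr B := Distr moment_fun_bimod moment_fun_ncC.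

Lemma moment_series_distr : moment_series distr_of_moments = M.
Proof.
apply: ser_word_inj; apply/funext => s.
rewrite -[LHS]/(moment_fun (ncX B * \prod_(x <- s) (ncC x * ncX B))).
pose W := foldr (fun x e => NCmul (NCmul (NCconst x) (NCX B)) e) (NCconst 1).
have -> : \prod_(x <- s) (ncC x * ncX B) = \pi_(ncpoly B) (W s).
  elim: s => [|x s IHs]; first by rewrite big_nil.
  by rewrite big_cons IHs /W /= !pi_ncmul.
rewrite -[ncX B * _]/(ncpoly_mul _ _) -pi_ncmul moment_fun_pi /moment_expr /=.
have actW k t : act (W s) k t 1 = k (catrev s t) 1.
  elim: s t => [|x s IHs] t /=; first by rewrite mulr1.
  by rewrite mul1r IHs.
rewrite actW /moment_cont catrevE rev_cat revK /=.
by rewrite mul1r mulr1.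
Qed.

End Moments.

Section MomentsUnique.
Local Open Scope quotient_scope.
Variables (K : fieldType) (B : algType K).

(** Two distributions with the same moments agree on monomials by the bimodule
    property.  That they agree everywhere follows by absorbing a polynomial, from
    left to right, in a monomial prefix L. *)
Lemma moment_series_unique (mu nu : distr B) :
  moment_series mu = moment_series nu -> forall x, mu x = nu x.
Proof.
move=> E.
pose L c s : ncpoly B := ncC c * \prod_(x <- s) (ncX B * ncC x).
have Lrcons c s b : L c (rcons s b) = L c s * (ncX B * ncC b).
  by rewrite /L -cats1 big_cat big_seq1 -[RHS]mulrA.
pose D y := forall c s, mu (L c s * y) = nu (L c s * y).
have D1 : D 1.
  move=> c s; rewrite mulr1; case/lastP: s => [|s b].
    by rewrite /L big_nil mulr1 !distr_ncC.
  have -> : L c (rcons s b) =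
      ncC c * (ncX B * \prod_(x <- in_tuple s) (ncC x * ncX B)) * ncC b.
    rewrite Lrcons /L -!mulrA; congr (_ * _); rewrite !mulrA; congr (_ * _).
    elim: s => [|x s IHs]; first by rewrite !big_nil mul1r mulr1.
    by rewrite !big_cons -mulrA IHs !mulrA.
  rewrite !distr_bimod; congr (_ * _ * _).
  by have := congr1 (fun F : ser B => F _ (in_tuple s)) E.
have DM p : forall y, D y -> D (\pi_(ncpoly B) p * y).
  elim: p => [|a|p IHp q IHq|p IHp q IHq] y Dy c s.
  - have := Dy c (rcons s 1); rewrite Lrcons.
    by rewrite -[ncC 1]/(1 : ncpoly B) mulr1 -!mulrA.
  - case/lastP: s => [|s b].
      have := Dy (c * a) [::]; rewrite /L !big_nil !mulr1 rmorphM /= -!mulrA.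
      exact.
    have := Dy c (rcons s (b * a)); rewrite !Lrcons rmorphM /= -!mulrA.
    exact.
  - rewrite (pi_ncadd p q : _ = (\pi p : ncpoly B) + (\pi q : ncpoly B)) mulrDl mulrDr !linearD.
    by rewrite IHp // IHq.
  - rewrite (pi_ncmul p q : _ = (\pi p : ncpoly B) * (\pi q : ncpoly B)) -mulrA.
    by apply: IHp; exact: IHq.
elim/ncpoly_ind => p; have := DM p 1 D1 1 [::].
by rewrite /L big_nil !mulr1 rmorph1 !mul1r.
Qed.

(** The components of the records other than the underlying function are proofs. *)
Lemma distr_inj (mu nu : distr B) : (forall x, mu x = nu x) -> mu = nu.
Proof.
case: mu nu => [[f [[fD] [fZ]]] fb fC] [[g [[gD] [gZ]]] gb gC] /= E.
have {}E : f = g by apply/funext.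
case: g / E gD gZ gb gC => gD gZ.
rewrite (Prop_irrelevance gD fD) (Prop_irrelevance gZ fZ) => gb gC.
by congr Distr; exact: Prop_irrelevance.
Qed.

End MomentsUnique.

(** * The maps BB on distributions *)

Section Distributions.
Variables (K : fieldType) (B : algType K).
Implicit Types (mu : distr B) (F : ser B).

Lemma moment_series_inj : injective (@moment_series K B).
Proof. by move=> mu nu /moment_series_unique/distr_inj. Qed.

Lemma is_RtransformP mu F : is_Rtransform mu F <-> moment_series mu = free_series F.
Proof.
split=> [E|E n b]; last by rewrite E.
by apply: ser_word_inj; apply/funext => s; exact: E.
Qed.

Lemma is_BtransformP mu F : is_Btransform mu F <-> moment_series mu = boolean_series F.
Proof.
split=> [E|E n b]; last by rewrite E.
by apply: ser_word_inj; apply/funext => s; exact: E.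
Qed.

Lemma free_series_Rtransform mu : free_series (Rtransform mu) = moment_series mu.
Proof.
have [g _ gK] := free_series_bij B.
have : is_Rtransform mu (g (moment_series mu)) by apply/is_RtransformP; rewrite gK.
by move=> h; apply/esym/is_RtransformP; exact: (xgetPex (zero_ser B) (ex_intro _ _ h)).
Qed.

Lemma boolean_series_Btransform mu : boolean_series (Btransform mu) = moment_series mu.
Proof.
have : is_Btransform mu (boolean_inverse (moment_series mu)).
  by apply/is_BtransformP; rewrite boolean_inverseK.
by move=> h; apply/esym/is_BtransformP; exact: (xgetPex (zero_ser B) (ex_intro _ _ h)).
Qed.

Lemma Rtransform_inj : injective (@Rtransform K B).
Proof.
move=> mu nu E; apply: moment_series_inj.
by rewrite -!free_series_Rtransform E.
Qed.

Lemma distr_of_RtransformK : cancel (@distr_of_Rtransform K B) (@Rtransform K B).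
Proof.
move=> F; apply: (xgetPex (distr0 B)
  (P := fun mu => Rtransform mu = F)).
exists (distr_of_moments (free_series F)).
apply: (bij_inj (free_series_bij B)).
by rewrite free_series_Rtransform moment_series_distr.
Qed.

Lemma Rtransform_BB (alpha : {linear B -> B}) mu :
  Rtransform (BB alpha mu) = RBhat alpha (Rtransform mu).
Proof. exact: distr_of_RtransformK. Qed.

(** Both sides have the moment series of mu as boolean moments. *)
Lemma Btransform_RBhat mu : Btransform mu = RBhat idfun (Rtransform mu).
Proof.
apply: (can_inj (@boolean_seriesK K B)).
by rewrite boolean_series_Btransform -free_series_boolean free_series_Rtransform.
Qed.

Lemma BB_comp (alpha beta : {linear B -> B}) mu :
  BB alpha (BB beta mu) = BB (alpha \+ beta) mu.
Proof. by apply: Rtransform_inj; rewrite !Rtransform_BB RBhat_comp. Qed.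

Lemma BBK (alpha : {linear B -> B}) : cancel (BB alpha) (BB (\- alpha)).
Proof. by move=> mu; apply: Rtransform_inj; rewrite !Rtransform_BB RBhatK. Qed.

Lemma BBKN (alpha : {linear B -> B}) : cancel (BB (\- alpha)) (BB alpha).
Proof. by move=> mu; apply: Rtransform_inj; rewrite !Rtransform_BB RBhatKN. Qed.

End Distributions.

Theorem theorem6p4 (R : realType) (B : cstarAlgType R) :
  [/\ forall alpha beta : {linear B -> B}, BB alpha \o BB beta = BB (alpha \+ beta),
      BB (\0 : {linear B -> B}) = id,
      forall alpha : {linear B -> B},
        [/\ bijective (BB alpha),
            cancel (BB alpha) (BB (\- alpha))
          & cancel (BB (\- alpha)) (BB alpha)]
    & BB (idfun : {linear B -> B}) = @bercovici_pata R[i] B ].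
Proof.
split.
- by move=> alpha beta; apply/funext => mu; exact: BB_comp.
- by apply/funext => mu; apply: Rtransform_inj; rewrite Rtransform_BB RBhat_zero.
- move=> alpha; split; [|exact: BBK|exact: BBKN].
  exact: Bijective (BBK alpha) (BBKN alpha).
- apply/funext => mu; apply: Rtransform_inj.
  by rewrite Rtransform_BB distr_of_RtransformK Btransform_RBhat.
Qed.
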